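(* Let $o\in\{\mathrm{dn},\mathrm{up}\}$ denote the terrestrial transmission mode sharing spectrum with the downlink (DL) satellite network. Then the ergodic spectral efficiency $R_{\mathrm{dn}}^{o}=\mathbb{E}[\log_2(1+\mathrm{SINR}_{\mathrm{dn}}^{o})]$ of the DL satellite network is $$R_{\mathrm{dn}}^{o}=\Bigl(1-e^{-\tilde\lambda_{\mathrm{s|u_s}}\pi\left((R_{\max}^{\mathrm{s|u_s}})^2-(R_{\min}^{\mathrm{s|u_s}})^2\right)}\Bigr)\int_0^\infty\int_{R_{\min}^{\mathrm{s|u_s}}}^{R_{\max}^{\mathrm{s|u_s}}}\Biggl[1-\sum_{z=0}^{m_{\mathrm s}-1}\frac{\zeta(z)\Gamma(z+1)}{(\beta-c)^{z+1}}\Biggl(1-\sum_{v=0}^{z}\frac{((\beta-c)\gamma r^{\alpha_{\mathrm s}})^v}{(G_1^{\mathrm{s|u_s}}P_{\mathrm s})^v\,v!}(-1)^v\frac{\mathrm d^v\mathcal L_r^{o}(s)}{\mathrm ds^v}\bigg|_{s=\frac{(\beta-c)\gamma r^{\alpha_{\mathrm s}}}{G_1^{\mathrm{s|u_s}}P_{\mathrm s}}}\Biggr)\Biggr]f(r)\,\frac{\log_2 e}{1+\gamma}\,\mathrm dr\,\mathrm d\gamma,$$ where $f$ is the conditional density of the distance $\|\mathbf x_1-\mathbf u_1^{\mathrm s}\|$ from the typical satellite user to the nearest satellite given that at least one satellite is visible, and $\mathcal L_r^{o}$ is the conditional Laplace transform of the aggregated interference plus noise power $I_{\mathrm{dn}}^{o}(r)$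 given that at least one satellite is visible and that this nearest distance equals $r$.
   Context: Geometry. All nodes lie on spheres centered at the origin of $\mathbb{R}^3$, except as stated for terrestrial users. The typical satellite user is fixed at $\mathbf u_1^{\mathrm s}=(0,0,R_{\mathrm{u_s}})$. Satellites and terrestrial base stations (BSs) lie on spheres of radii $R_{\mathrm s}$ and $R_{\mathrm b}$, both larger than $R_{\mathrm{u_s}}$, and form independent homogeneous Poisson point processes $\Phi_{\mathrm s}=\{\mathbf x_n\}$, $\Phi_{\mathrm b}=\{\mathbf b_m\}$ with densities $\lambda_{\mathrm s},\lambda_{\mathrm b}>0$ per unit area. The elevation angle is $\theta_{\mathrm{u_s}}\in[0,\pi/2)$. For $o\in\{\mathrm s,\mathrm b\}$ put $$R_{\min}^{o|\mathrm{u_s}}=R_o-R_{\mathrm{u_s}},\quad R_{\max}^{o|\mathrm{u_s}}=\sqrt{R_o^2-R_{\mathrm{u_s}}^2+R_{\mathrm{u_s}}^2\sin^2\theta_{\mathrm{u_s}}}-R_{\mathrm{u_s}}\sin\theta_{\mathrm{u_s}},\quad\tilde\lambda_{o|\mathrm{u_s}}=\lambda_o\frac{R_o}{R_{\mathrm{u_s}}}.$$ The visible cap $\mathcal A_{o|\mathrm{u_s}}$ is the set of points of the sphere of radius $R_o$ at distance at most $R_{\max}^{o|\mathrm{u_s}}$ from $\mathbf u_1^{\mathrm s}$, and $\mathcal A_{o|\mathrm{u_s}}(r)$ is the set of those at distance at most $r$. The terrestrial users visible to the typical satellite user form, independently of everything else, a homogeneous Poisson point process $\Phi_{\mathrm{u_t}}=\{\mathbf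 u_k^{\mathrm t}\}$ of density $\lambda_{\mathrm{u_t}}>0$ in the planar disc $\mathcal A_{\mathrm{u_t|u_s}}$ of radius $R_{\max}^{\mathrm{u_t|u_s}}>0$ centered at $\mathbf u_1^{\mathrm s}$. ''At least one satellite is visible'' is the event $\Phi_{\mathrm s}(\mathcal A_{\mathrm{s|u_s}})\ge1$; $\mathbf x_1$ is the visible satellite nearest to $\mathbf u_1^{\mathrm s}$, which is the serving one. Gains. With carrier frequency $f_c$, speed of light $c_0$ and positive lobe gains: $G_1^{\mathrm{s|u_s}}=G_{\mathrm{u_s}}^{\mathrm{main}}G_{\mathrm s}^{\mathrm{main}}(c_0/4\pi f_c)^2$; $G_n^{\mathrm{s|u_s}}=G_{\mathrm{u_s}}^{\mathrm{side}}G_{\mathrm s}^{\mathrm{side}}(c_0/4\pi f_c)^2$ for $n\neq1$; $G^{\mathrm{b|u_s}}=G^{\mathrm{b_H|u_s}}=G_{\mathrm{u_s}}^{\mathrm{side}}G_{\mathrm{b_H}}^{\mathrm{side}}(c_0/4\pi f_c)^2$; $G^{\mathrm{u_t|u_s}}=G_{\mathrm{u_s}}^{\mathrm{side}}G_{\mathrm{u_t}}^{\mathrm{side}}(c_0/4\pi f_c)^2$. Fading. All fading powers are mutually independent and independent of the point processes. The satellite fading powers $H_n^{\mathrm s}$ are i.i.d., $\sqrt{H^{\mathrm s}}$ being Shadowed-Rician with density $$\Bigl(\tfrac{2bm_{\mathrm s}}{2bm_{\mathrm s}+\Omega}\Bigr)^{m_{\mathrm s}}\tfrac{x}{b}\,e^{-x^2/(2b)}\,{}_1F_1\Bigl(m_{\mathrm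 s};1;\tfrac{\Omega x^2}{2b(2bm_{\mathrm s}+\Omega)}\Bigr),\quad x>0,$$ with $b,\Omega>0$, $m_{\mathrm s}$ a positive integer, ${}_1F_1$ the confluent hypergeometric function. The terrestrial fading powers $H^{\mathrm t}$ are i.i.d., $\sqrt{H^{\mathrm t}}$ being Nakagami with density $\frac{2m_{\mathrm t}^{m_{\mathrm t}}}{\Gamma(m_{\mathrm t})}x^{2m_{\mathrm t}-1}e^{-m_{\mathrm t}x^2}$, $x>0$, $m_{\mathrm t}>0$. Constants: $\beta=\frac1{2b}$, $c=\frac{\Omega}{2b(2bm_{\mathrm s}+\Omega)}$, $\zeta(z)=\bigl(\frac{2bm_{\mathrm s}}{2bm_{\mathrm s}+\Omega}\bigr)^{m_{\mathrm s}}\frac{\beta(-1)^z(1-m_{\mathrm s})_z c^z}{(z!)^2}$, with $(x)_z=x(x+1)\cdots(x+z-1)$ and $(x)_0=1$. Signals. $P_{\mathrm s},P_{\mathrm b},P_{\mathrm{u_t}}>0$ are transmit powers, $\sigma^2>0$ noise power, $\alpha_{\mathrm s},\alpha_{\mathrm t}>0$ the path-loss exponents of satellite and terrestrial links. On the event that a satellite is visible, $$\mathrm{SINR}_{\mathrm{dn}}^{o}=\frac{G_1^{\mathrm{s|u_s}}P_{\mathrm s}H_1^{\mathrm s}\|\mathbf x_1-\mathbf u_1^{\mathrm s}\|^{-\alpha_{\mathrm s}}}{I_{\mathrm s}^{\mathrm{dn}}+I_{\mathrm{t,dn}}^{o}+\sigma^2},$$ with $I_{\mathrm s}^{\mathrm{dn}}=\sum_{\mathbf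 x_n\in(\Phi_{\mathrm s}\cap\mathcal A_{\mathrm{s|u_s}})\setminus\{\mathbf x_1\}}G_n^{\mathrm{s|u_s}}P_{\mathrm s}H_n^{\mathrm s}\|\mathbf x_n-\mathbf u_1^{\mathrm s}\|^{-\alpha_{\mathrm s}}$, $I_{\mathrm{t,dn}}^{\mathrm{dn}}=\sum_{\mathbf b_m\in\Phi_{\mathrm b}\cap\mathcal A_{\mathrm{b|u_s}}}G^{\mathrm{b|u_s}}P_{\mathrm b}H_m^{\mathrm t}\|\mathbf b_m-\mathbf u_1^{\mathrm s}\|^{-\alpha_{\mathrm t}}$, $I_{\mathrm{t,dn}}^{\mathrm{up}}=\sum_{\mathbf u_k^{\mathrm t}\in\Phi_{\mathrm{u_t}}\cap\mathcal A_{\mathrm{u_t|u_s}}}G^{\mathrm{u_t|u_s}}P_{\mathrm{u_t}}H_k^{\mathrm t}\|\mathbf u_k^{\mathrm t}-\mathbf u_1^{\mathrm s}\|^{-\alpha_{\mathrm t}}$. If no satellite is visible, $\mathrm{SINR}_{\mathrm{dn}}^{o}=0$. For $\|\mathbf x_1-\mathbf u_1^{\mathrm s}\|=r$, $I_{\mathrm{dn}}^{o}(r)=\sum_{\mathbf x_n\in\Phi_{\mathrm s}\cap(\mathcal A_{\mathrm{s|u_s}}\setminus\mathcal A_{\mathrm{s|u_s}}(r))}G_n^{\mathrm{s|u_s}}P_{\mathrm s}H_n^{\mathrm s}\|\mathbf x_n-\mathbf u_1^{\mathrm s}\|^{-\alpha_{\mathrm s}}+I_{\mathrm{t,dn}}^{o}+\sigma^2$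 (all gains in this sum are the side-lobe ones), and $\mathcal L_r^{o}(s)=\mathbb E\bigl[e^{-sI_{\mathrm{dn}}^{o}(r)}\,\big|\,\|\mathbf x_1-\mathbf u_1^{\mathrm s}\|=r,\ \Phi_{\mathrm s}(\mathcal A_{\mathrm{s|u_s}})\ge1\bigr]$. *)

(* Defs.v *)
From mathcomp Require Import all_boot all_order all_algebra.
From mathcomp Require Import all_classical all_reals all_analysis.

Set Implicit Arguments.
Unset Strict Implicit.
Unset Printing Implicit Defensive.

Import Order.TTheory GRing.Theory Num.Theory.
Import numFieldNormedType.Exports.

Local Open Scope classical_set_scope.
Local Open Scope ring_scope.

Section special_functions.
Context {R : realType}.

Definition log2 (x : R) : R := ln x / ln 2.

Definition Gamma (x : R) : R :=
  \int[lebesgue_measure]_(t in `]0, +oo[) (t `^ (x - 1) * expR (- t)).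

Definition pochhammer (x : R) (z : nat) : R := \prod_(i < z) (x + i%:R).

Definition hyp1F1 (a b x : R) : R :=
  limn (series (fun k => pochhammer a k / pochhammer b k * x ^+ k / k`!%:R)).

End special_functions.

(* R^3 as (x, y, z); the norm of the library on products is the sup norm,
   hence an explicit Euclidean distance. *)
Section space.
Context {R : realType}.

Definition dot3 (x y : R * R * R) : R :=
  x.1.1 * y.1.1 + x.1.2 * y.1.2 + x.2 * y.2.

Definition dist3 (x y : R * R * R) : R := Num.sqrt (dot3 (x - y) (x - y)).

Definition sphere3 (rho : R) : set (R * R * R) := [set x | dist3 x 0 = rho].

Definition sphere_param (rho : R) (a : R * R) : R * R * R :=
  (rho * sin a.1 * cos a.2, rho * sin a.1 * sin a.2, rho * cos a.1).

Definition sphere_chart : set (R * R) := `[0, pi] `*` `[0, 2 * pi].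

(* Area of B `&` sphere3 rho: [rho ^+ 2 * sin a.1] is the norm of the cross
   product of the two partial derivatives of [sphere_param rho] at [a]. *)
Definition sphere_area (rho : R) (B : set (R * R * R)) : \bar R :=
  (\int[lebesgue_measure \x lebesgue_measure]_(a in
      sphere_chart `&` sphere_param rho @^-1` B)
    (rho ^+ 2 * sin a.1)%:E)%E.

Definition plane_param (u e1 e2 : R * R * R) (a : R * R) : R * R * R :=
  u + (a.1 *: e1 + a.2 *: e2).

Definition disc (u e1 e2 : R * R * R) (rho : R) : set (R * R * R) :=
  range (plane_param u e1 e2) `&` [set x | dist3 x u <= rho].

(* Area of B `&` disc u e1 e2 rho, for orthonormal e1, e2. *)
Definition disc_area (u e1 e2 : R * R * R) (rho : R) (B : set (R * R * R)) :
    \bar R :=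
  ((lebesgue_measure \x lebesgue_measure)
    (plane_param u e1 e2 @^-1` (disc u e1 e2 rho `&` B)))%E.

End space.

Section probability_notions.
Context {R : realType} {d : measure_display} {T : measurableType d}.
Variable P : probability T R.

(* Each F i is meant to be a sigma-algebra: the product rule is only assumed for
   one event per index of a finite set of pairwise distinct indices. *)
Definition mutually_independent (I : Type) (F : I -> set (set T)) : Prop :=
  forall (n : nat) (J : 'I_n -> I) (A : 'I_n -> set T), injective J ->
    (forall k, F (J k) (A k)) ->
    fine (P (\bigcap_(k in [set: 'I_n]) A k)) = \prod_(k < n) fine (P (A k)).

Definition has_density_pos (X : T -> R) (g : R -> R) : Prop :=
  forall B : set R, measurable B ->
    P (X @^-1` B) = (\int[lebesgue_measure]_(x in B `&` `]0%R, +oo[) (g x)%:E)%E.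

Definition is_cond_density (E : set T) (X : T -> R) (f : R -> R) : Prop :=
  [/\ measurable_fun [set: R] f, (forall r, 0 <= f r) &
      forall B : set R, measurable B ->
        P (E `&` X @^-1` B) =
        (P E * \int[lebesgue_measure]_(r in B) (f r)%:E)%E].

(* kappa is a regular conditional distribution of Y given X = r and E. *)
Definition is_cond_law (E : set T) (X Y : T -> R)
    (kappa : R.-pker (measurableTypeR R) ~> (measurableTypeR R)) : Prop :=
  forall B C : set R, measurable B -> measurable C ->
    P (E `&` X @^-1` B `&` Y @^-1` C) =
    (\int[P]_(w in E `&` X @^-1` B) kappa (X w) C)%E.

(* An almost surely finite point process on R^3 is given by its number of
   points and an enumeration of them: it is {pt n w | n < npt w}, and pt n w is
   irrelevant when npt w <= n. *)
Record point_process := PointProcess {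
  npt : {RV P >-> nat} ;
  pt : nat -> {RV P >-> (R * R * R)%type} }.

Definition pp_count (Phi : point_process) (B : set (R * R * R)) (w : T) : nat :=
  (\sum_(n < npt Phi w) `[< B (pt Phi n w) >])%N.

(* The sigma-algebra of the enumerated process (not only of its counts), so
   that fadings independent of it are independent of the labels too. *)
Definition pp_sigma (Phi : point_process) : set (set T) :=
  <<s [set A | exists n B, measurable B /\
        A = [set w | (n < npt Phi w)%N /\ B (pt Phi n w)]] >>.

Definition rv_sigma (X : T -> R) : set (set T) :=
  [set A | exists2 B : set R, measurable B & A = X @^-1` B].

(* Poisson point process with (finite) intensity measure Lambda. The second
   argument of [poisson_prob] is a dummy that its definition ignores. *)
Definition is_poisson_process (Phi : point_process)
    (Lambda : set (R * R * R) -> \bar R) : Prop :=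
  (forall B, measurable B -> forall U : set nat,
     P (pp_count Phi B @^-1` U) = poisson_prob (fine (Lambda B)) 0%N U) /\
  (forall (n : nat) (B : 'I_n -> set (R * R * R)) (U : 'I_n -> set nat),
     (forall i, measurable (B i)) -> trivIset [set: 'I_n] B ->
     fine (P (\bigcap_(i in [set: 'I_n]) (pp_count Phi (B i) @^-1` U i))) =
     \prod_(i < n) fine (P (pp_count Phi (B i) @^-1` U i))).

End probability_notions.

(* Dn: the base stations transmit; Up: the terrestrial users transmit. *)
Inductive mode := Dn | Up.

Inductive layer := Sat | Bs | Ut.

Definition terrestrial (o : mode) : layer :=
  match o with Dn => Bs | Up => Ut end.

Record params (R : realType) := Params {
  R_us : R ; R_s : R ; R_b : R ;
  theta : R ;
  lam_s : R ; lam_b : R ; lam_ut : R ;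
  (* radius of the disc of the terrestrial users, and an orthonormal frame of
     its (arbitrary) plane *)
  R_ut : R ; e1 : R * R * R ; e2 : R * R * R ;
  f_c : R ; c_0 : R ;
  Gus_main : R ; Gus_side : R ; Gs_main : R ; Gs_side : R ;
  Gb_side : R ; Gut_side : R ;
  (* Shadowed-Rician parameters b, Omega, m_s; Nakagami parameter m_t *)
  sr_b : R ; sr_Omega : R ; m_s : nat ; m_t : R ;
  P_s : R ; P_b : R ; P_ut : R ;
  sigma2 : R ;
  alpha_s : R ; alpha_t : R }.

Record valid_params (R : realType) (p : params R) : Prop := ValidParams {
  R_us_gt0 : 0 < R_us p ;
  R_s_gt : R_us p < R_s p ;
  R_b_gt : R_us p < R_b p ;
  theta_itv : 0 <= theta p < pi / 2 ;
  lam_s_gt0 : 0 < lam_s p ;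
  lam_b_gt0 : 0 < lam_b p ;
  lam_ut_gt0 : 0 < lam_ut p ;
  R_ut_gt0 : 0 < R_ut p ;
  e1_unit : dot3 (e1 p) (e1 p) = 1 ;
  e2_unit : dot3 (e2 p) (e2 p) = 1 ;
  e12_orth : dot3 (e1 p) (e2 p) = 0 ;
  f_c_gt0 : 0 < f_c p ;
  c_0_gt0 : 0 < c_0 p ;
  Gus_main_gt0 : 0 < Gus_main p ;
  Gus_side_gt0 : 0 < Gus_side p ;
  Gs_main_gt0 : 0 < Gs_main p ;
  Gs_side_gt0 : 0 < Gs_side p ;
  Gb_side_gt0 : 0 < Gb_side p ;
  Gut_side_gt0 : 0 < Gut_side p ;
  sr_b_gt0 : 0 < sr_b p ;
  sr_Omega_gt0 : 0 < sr_Omega p ;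
  m_s_gt0 : (0 < m_s p)%N ;
  m_t_gt0 : 0 < m_t p ;
  P_s_gt0 : 0 < P_s p ;
  P_b_gt0 : 0 < P_b p ;
  P_ut_gt0 : 0 < P_ut p ;
  sigma2_gt0 : 0 < sigma2 p ;
  alpha_s_gt0 : 0 < alpha_s p ;
  alpha_t_gt0 : 0 < alpha_t p }.

Section constants.
Context {R : realType} (p : params R).

Definition u1 : R * R * R := (0, 0, R_us p).

Definition Rmin (Ro : R) : R := Ro - R_us p.

Definition Rmax (Ro : R) : R :=
  Num.sqrt (Ro ^+ 2 - R_us p ^+ 2 + R_us p ^+ 2 * sin (theta p) ^+ 2)
  - R_us p * sin (theta p).

Definition lam_tilde (lam Ro : R) : R := lam * (Ro / R_us p).

Definition Rmin_s : R := Rmin (R_s p).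
Definition Rmax_s : R := Rmax (R_s p).
Definition lam_tilde_s : R := lam_tilde (lam_s p) (R_s p).

Definition cap (Ro r : R) : set (R * R * R) :=
  sphere3 Ro `&` [set x | dist3 x u1 <= r].

Definition visible_region (l : layer) : set (R * R * R) :=
  match l with
  | Sat => cap (R_s p) (Rmax (R_s p))
  | Bs => cap (R_b p) (Rmax (R_b p))
  | Ut => disc u1 (e1 p) (e2 p) (R_ut p)
  end.

Definition intensity (l : layer) (B : set (R * R * R)) : \bar R :=
  match l with
  | Sat => ((lam_s p)%:E * sphere_area (R_s p) B)%E
  | Bs => ((lam_b p)%:E * sphere_area (R_b p) B)%E
  | Ut => ((lam_ut p)%:E * disc_area u1 (e1 p) (e2 p) (R_ut p) B)%E
  end.

Definition gain_main_s : R :=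
  Gus_main p * Gs_main p * (c_0 p / (4 * pi * f_c p)) ^+ 2.

Definition gain_side (l : layer) : R :=
  Gus_side p * match l with
               | Sat => Gs_side p | Bs => Gb_side p | Ut => Gut_side p
               end * (c_0 p / (4 * pi * f_c p)) ^+ 2.

Definition power (l : layer) : R :=
  match l with Sat => P_s p | Bs => P_b p | Ut => P_ut p end.

Definition alpha (l : layer) : R :=
  match l with Sat => alpha_s p | Bs | Ut => alpha_t p end.

Definition shadowed_rician (x : R) : R :=
  let b := sr_b p in let Om := sr_Omega p in let m := (m_s p)%:R in
  (2 * b * m / (2 * b * m + Om)) ^+ m_s p * (x / b)
  * expR (- (x ^+ 2 / (2 * b)))
  * hyp1F1 m 1 (Om * x ^+ 2 / (2 * b * (2 * b * m + Om))).

Definition nakagami (x : R) : R :=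
  2 * m_t p `^ m_t p / Gamma (m_t p) * x `^ (2 * m_t p - 1)
  * expR (- (m_t p * x ^+ 2)).

Definition fading_density (l : layer) : R -> R :=
  match l with Sat => shadowed_rician | Bs | Ut => nakagami end.

Definition beta : R := (2 * sr_b p)^-1.

Definition cc : R :=
  sr_Omega p / (2 * sr_b p * (2 * sr_b p * (m_s p)%:R + sr_Omega p)).

Definition zeta (z : nat) : R :=
  (2 * sr_b p * (m_s p)%:R / (2 * sr_b p * (m_s p)%:R + sr_Omega p)) ^+ m_s p
  * (beta * (-1) ^+ z * pochhammer (1 - (m_s p)%:R) z * cc ^+ z
     / z`!%:R ^+ 2).

End constants.

Section network.
Context {R : realType} {d : measure_display} {T : measurableType d}.
Variables (P : probability T R) (p : params R).

(* [fading l n] is the fading power of the link of the n-th point of layer l. *)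
Record network := Network {
  points : layer -> point_process P ;
  fading : layer -> nat -> {RV P >-> R} }.

(* The independent sources of randomness: (l, None) is the point process of
   layer l, and (l, Some n) its n-th fading power. *)
Definition source_sigma (N : network) (i : layer * option nat) : set (set T) :=
  match i with
  | (l, None) => pp_sigma (points N l)
  | (l, Some n) => rv_sigma (fading N l n)
  end.

Record network_model (N : network) : Prop := NetworkModel {
  points_poisson : forall l, is_poisson_process (points N l) (intensity p l) ;
  fading_law : forall l n,
    has_density_pos P (fun w => Num.sqrt (fading N l n w)) (fading_density p l) ;
  sources_independent : mutually_independent P (source_sigma N) }.

Variable N : network.

Definition visible (l : layer) (w : T) (n : nat) : Prop :=
  (n < npt (points N l) w)%N /\ visible_region p l (pt (points N l) n w).

Definition dist_to (l : layer) (w : T) (n : nat) : R :=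
  dist3 (pt (points N l) n w) (u1 p).

(* At distance 0, a null event, [powR] makes this 0. *)
Definition received (l : layer) (w : T) (n : nat) : R :=
  power p l * fading N l n w * dist_to l w n `^ (- alpha p l).

Definition some_visible : set T :=
  [set w | (1 <= pp_count (points N Sat) (visible_region p Sat) w)%N].

(* Label of the nearest visible satellite; ties, which have probability 0, are
   resolved by the smallest label. *)
Definition serving (w : T) : nat :=
  xget 0%N [set n | visible Sat w n /\ forall k, visible Sat w k ->
    dist_to Sat w n < dist_to Sat w k \/
    (dist_to Sat w n = dist_to Sat w k /\ (n <= k)%N)].

Definition serving_dist (w : T) : R := dist_to Sat w (serving w).

Definition interference_sat (w : T) : R :=
  \sum_(n < npt (points N Sat) w |
        `[< visible Sat w n >] && (nat_of_ord n != serving w))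
    gain_side p Sat * received Sat w n.

Definition interference_ter (o : mode) (w : T) : R :=
  \sum_(n < npt (points N (terrestrial o)) w |
        `[< visible (terrestrial o) w n >])
    gain_side p (terrestrial o) * received (terrestrial o) w n.

Definition SINR (o : mode) (w : T) : R :=
  if `[< some_visible w >] then
    gain_main_s p * received Sat w (serving w)
    / (interference_sat w + interference_ter o w + sigma2 p)
  else 0.

(* I_dn^o(r): aggregated interference plus noise power, the satellites at
   distance at most r being excluded. *)
Definition interference_noise (o : mode) (r : R) (w : T) : R :=
  \sum_(n < npt (points N Sat) w |
        `[< visible Sat w n /\
            ~ cap p (R_s p) r (pt (points N Sat) n w) >])
    gain_side p Sat * received Sat w n
  + interference_ter o w + sigma2 p.

(* f is the conditional density of the distance to the nearest satellite given
   that a satellite is visible. *)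
Definition nearest_distance_density (f : R -> R) : Prop :=
  is_cond_density P some_visible serving_dist f.

(* Since [serving_dist w = r] is a null event, conditioning on it is made
   precise by a regular conditional distribution kappa of
   I_dn^o(serving_dist). *)
Definition interference_cond_law (o : mode)
    (kappa : R.-pker (measurableTypeR R) ~> (measurableTypeR R)) : Prop :=
  is_cond_law P some_visible serving_dist
    (fun w => interference_noise o (serving_dist w) w) kappa.

End network.

Definition laplace_transform (R : realType)
    (kappa : R.-pker (measurableTypeR R) ~> (measurableTypeR R)) (r s : R) : R :=
  \int[kappa r]_(y in [set: measurableTypeR R]) expR (- (s * y)).

(* Main.v *)
(** The ergodic rate is the integral over gamma of
    P(SINR > gamma) log2(e) / (1 + gamma). On the event that a satellite is
    visible, SINR > gamma means that the fading of the serving satellite exceeds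
    a multiple of X^alpha Y, where X is the serving distance and Y the
    interference plus noise. Given that satellite n serves, X and Y are functions
    of all the sources of randomness except the fading of n, so this fading may
    be integrated out first: its distribution function is explicit, because
    Kummer's transformation turns the Shadowed-Rician density into a finite sum
    of Gamma densities. What is left is the expectation of a finite sum of terms
    (s Y)^v e^(- s Y), which the conditional law of Y given X and the density of
    X turn into derivatives of the Laplace transform. *)

From HB Require Import structures.
From mathcomp Require Import all_boot all_order all_algebra.
From mathcomp Require Import all_classical all_reals all_analysis.
From mathcomp Require Import measurable_realfun.
From mathcomp Require Import ring lra.
Require Import Defs.

Set Implicit Arguments.
Unset Strict Implicit.
Unset Printing Implicit Defensive.

Import Order.TTheory GRing.Theory Num.Theory.
Import numFieldNormedType.Exports.

Local Open Scope classical_set_scope.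
Local Open Scope ring_scope.

(** * Measure theory *)

(** Three obstacles shape the proof. The serving satellite carries a random label, while
    independence is assumed only between sources with fixed labels. The visibility event is
    therefore partitioned by the serving label, and on each piece the fading of that label is erased
    from the network, which changes neither the serving distance nor the interference plus noise
    there. Next, the SINR discards one label from the interference, whereas I_dn^o(r) discards every
    satellite at distance at most r. The two agree unless two visible satellites are equidistant,
    and that this is a null event rests on an area estimate for thin slices of the sphere. Finally,
    neither log2(1 + SINR) nor the integrand of the formula is shown to be measurable: the latter
    contains derivatives of Laplace transforms of measures [kappa r] that are arbitrary for a null
    set of r. Both are compared, off null sets, with measurable substitutes: indicators of tail
    events and integrals against the kernel. *)

Section nonmeasurable_ae.
Context d (T : measurableType d) (R : realType).
Variable mu : {measure set T -> \bar R}.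
Local Open Scope ereal_scope.
Import HBNNSimple.

Let ge0_integral_le_off (f g : T -> \bar R) (M : set T) :
  measurable M -> mu M = 0 ->
  (forall x, 0 <= f x) -> (forall x, 0 <= g x) ->
  (forall x, ~ M x -> f x = g x) -> \int[mu]_x f x <= \int[mu]_x g x.
Proof.
move=> mM M0 f0 g0 fg.
rewrite ge0_integralTE// ge0_integralTE//.
apply: ge_ereal_sup => _ [h /= hf <-].
pose h' : {nnsfun T >-> R} := mul_nnsfun h (indic_nnsfun R (measurableC mM)).
have hh' : sintegral mu h <= sintegral mu h'.
  rewrite -!integralT_nnsfun le_eqVlt; apply/orP; left; apply/eqP.
  apply: ge0_ae_eq_integral => //.
  - exact/measurable_EFinP.
  - exact/measurable_EFinP.
  - by move=> x _; rewrite lee_fin.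
  - by move=> x _; rewrite lee_fin.
  - exists M; split => // x /= /not_implyP[_]; apply: contra_notP => Mx.
    by rewrite /= mindicE mem_set// mulr1.
apply: (le_trans hh'); apply: ereal_sup_ubound; exists h' => // x /=.
rewrite mindicE; case: (boolP (x \in ~` M)) => [|_].
  by rewrite inE /= => Mx; rewrite mulr1 -fg.
by rewrite mulr0.
Qed.

(* Unlike [ge0_ae_eq_integral], no measurability is required of the functions:
   the integral is a supremum over simple functions, which may be cut off on a
   null set. *)
Lemma integral_eq_off (D : set T) (f g : T -> \bar R) (M : set T) :
  measurable M -> mu M = 0 ->
  (forall x, D x -> ~ M x -> f x = g x) ->
  \int[mu]_(x in D) f x = \int[mu]_(x in D) g x.
Proof.
move=> mM M0 fg.
rewrite integral_mkcond [RHS]integral_mkcond.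
rewrite [LHS]integralE [RHS]integralE.
have H (h : T -> \bar R) (h' : T -> \bar R) :
    (forall x, 0 <= h x) -> (forall x, 0 <= h' x) ->
    (forall x, ~ M x -> h x = h' x) -> \int[mu]_x h x = \int[mu]_x h' x.
  move=> h0 h'0 hh'; apply/eqP; rewrite eq_le; apply/andP; split.
    exact: (ge0_integral_le_off mM).
  by apply: (ge0_integral_le_off mM) => // x /hh'.
congr (_ - _).
  apply: H => x; first exact: funepos_ge0.
    exact: funepos_ge0.
  move=> Mx; rewrite !funeposE /patch; case: ifPn => // /set_mem Dx.
  by rewrite fg.
apply: H => x; first exact: funeneg_ge0.
  exact: funeneg_ge0.
move=> Mx; rewrite !funenegE /patch; case: ifPn => // /set_mem Dx.
by rewrite fg.
Qed.

End nonmeasurable_ae.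

(** * Induction on nonnegative measurable functions *)

Section ge0_induction.
Context d (T : measurableType d) (R : realType).
Local Open Scope ereal_scope.
Import HBNNSimple.

(** A simple function is a finite combination of indicators of its fibres, and [nnsfun_approx]
    increases to any nonnegative measurable function. *)
Lemma ge0_measurable_ind (Q : (T -> \bar R) -> Prop) :
  (forall A, measurable A -> Q (EFin \o \1_A)) ->
  (forall (c : R) f, (0 <= c)%R -> measurable_fun setT f ->
     (forall x, 0 <= f x) -> Q f -> Q (fun x => c%:E * f x)) ->
  (forall f g, measurable_fun setT f -> (forall x, 0 <= f x) -> Q f ->
     measurable_fun setT g -> (forall x, 0 <= g x) -> Q g ->
     Q (fun x => f x + g x)) ->
  (forall F : nat -> T -> \bar R, (forall n, measurable_fun setT (F n)) ->
     (forall n x, 0 <= F n x) -> (forall n, Q (F n)) ->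
     (forall x, nondecreasing_seq (F ^~ x)) -> Q (fun x => limn (F ^~ x))) ->
  forall f, measurable_fun setT f -> (forall x, 0 <= f x) -> Q f.
Proof.
move=> Q1 QZ QD Qlim f mf f0.
have Qs (h : {nnsfun T >-> R}) : Q (EFin \o h).
  pose F (s : seq R) (x : T) : \bar R :=
    \sum_(y <- s) y%:E * (\1_(h @^-1` [set y]) x)%:E.
  have mF s : (forall y, y \in s -> (0 <= y)%R) ->
      [/\ measurable_fun setT (F s), forall x, 0 <= F s x & Q (F s)].
    elim: s => [|y s ih] s0.
      (* No clause of the induction gives the zero function directly; it enters as the indicator of
         the empty set. *)
      have -> : F [::] = EFin \o \1_(set0 : set T).
        by apply/funext => x; rewrite /F big_nil /= indic0.
      split; last exact: Q1.
      - exact/measurable_EFinP/measurable_indic.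
      - by move=> x /=; rewrite lee_fin.
    have [ms s_ge0 Qss] := ih (fun z zs => s0 z (mem_behead (s := y :: s) zs)).
    have y0 : (0 <= y)%R by apply: s0; rewrite mem_head.
    have -> : F (y :: s) = (fun x => y%:E * (EFin \o \1_(h @^-1` [set y])) x + F s x).
      by apply/funext => x; rewrite /F big_cons.
    have my : measurable (h @^-1` [set y]) by [].
    have m1 : measurable_fun setT (EFin \o \1_(h @^-1` [set y]) : T -> \bar R).
      exact/measurable_EFinP/measurable_indic.
    have m2 : measurable_fun setT (fun x => y%:E * (EFin \o \1_(h @^-1` [set y])) x).
      exact: measurable_funeM.
    split.
    - exact: emeasurable_funD.
    - by move=> x; rewrite adde_ge0// mule_ge0 ?lee_fin.
    - apply: QD => //; first by move=> x; rewrite mule_ge0 ?lee_fin.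
      by apply: QZ => //; [move=> x; rewrite lee_fin | exact: Q1].
  have -> : EFin \o h = F (finmap.enum_fset (fset_set (range h))).
    apply/funext => x /=; rewrite fimfunE fsbig_finite//= /F sumEFin.
    by [].
  have hs y : y \in finmap.enum_fset (fset_set (range h)) -> (0 <= y)%R.
    by rewrite in_fset_set// inE => -[x _ <-]; exact: fun_ge0.
  by have [] := mF _ hs.
pose g := nnsfun_approx measurableT mf.
have fE : (fun x => limn ((fun n => EFin \o g n) ^~ x)) = f.
  by apply/funext => x; apply/cvg_lim => //; exact: cvg_nnsfun_approx.
suff : Q (fun x => limn ((fun n => EFin \o g n) ^~ x)) by rewrite fE.
apply: Qlim => //.
- by move=> n; exact/measurable_EFinP.
- by move=> n x /=; rewrite lee_fin.
- by move=> x m n mn /=; rewrite lee_fin; exact/lefP/nd_nnsfun_approx.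
Qed.

End ge0_induction.

(** * Independence of one source from all the others *)

Section independence.
Context d (T : measurableType d) (R : realType) (P : probability T R).

(** Duplicate-free lists replace injections from ordinals, so that an index can be put in front of a
    list and two lists can be merged. *)
Lemma mutually_independent_seq (I : choiceType) (F : I -> set (set T))
    (s : seq I) (A : I -> set T) :
  mutually_independent P F -> uniq s -> (forall i, i \in s -> F i (A i)) ->
  fine (P (\bigcap_(i in [set` s]) A i)) = \prod_(i <- s) fine (P (A i)).
Proof.
move=> indF us sA.
pose J (k : 'I_(size s)) := tnth (in_tuple s) k.
have injJ : injective J by exact/tuple_uniqP.
have := indF _ J (A \o J) injJ.
have -> : \bigcap_(k in [set: 'I_(size s)]) (A \o J) k =
          \bigcap_(i in [set` s]) A i.
  apply/seteqP; split=> w /= h i.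
    by move=> /(tnthP (in_tuple s))[k ->]; exact: h.
  by move=> _; apply: h => /=; exact: mem_tnth.
move=> ->; first by rewrite big_tnth.
by move=> k; apply: sA; exact: mem_tnth.
Qed.

(** Finite intersections of events with indices other than j form a pi-system [G] that generates the
    left sigma-algebra. On [G] the finite measures P(. [&] B) and P(B) P(.) agree by the product
    rule, hence they agree on what [G] generates. *)
Lemma independent_rest (I : choiceType) (F : I -> set (set T)) (j : I)
    (A B : set T) :
  mutually_independent P F -> (forall i, F i `<=` measurable) ->
  (forall i, setI_closed (F i)) -> (forall i, F i setT) ->
  <<s \bigcup_(i in [set i | i != j]) F i >> A -> F j B ->
  P (A `&` B) = (P A * P B)%E.
Proof.
move=> indF mF FI FT GA FB.
have mB := mF _ _ FB.
pose G : set (set T) := [set C | exists s : seq I, exists2 A' : I -> set T,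
  [/\ uniq s, j \notin s & forall i, F i (A' i)] &
  C = \bigcap_(i in [set` s]) A' i].
have mfb s A' : (forall i, F i (A' i)) ->
    measurable (\bigcap_(i in [set` (s : seq I)]) A' i).
  by move=> FA'; rewrite bigcap_seq; apply: bigsetI_measurable => i _; exact: mF.
have GI : setI_closed G.
  move=> _ _ [s [A' [us js FA'] ->]] [s' [A'' [us' js' FA''] ->]].
  (* An index missing from one list contributes [setT] there, so the intersection is again one event
     per index. *)
  exists (undup (s ++ s')), (fun i => (if i \in s then A' i else setT) `&`
    (if i \in s' then A'' i else setT)).
    split; first exact: undup_uniq.
      by rewrite mem_undup mem_cat negb_or js.
    by move=> i; apply: FI; case: ifP.
  apply/seteqP; split=> w /=.
    move=> [h h'] i /= _; split; case: ifPn => // ii; [exact: h|exact: h'].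
  move=> h; split=> i /= ii.
    have [] := h i; first by rewrite /= mem_undup mem_cat ii.
    by rewrite ii.
  have [] := h i; first by rewrite /= mem_undup mem_cat ii orbT.
  by rewrite ii.
have mG : G `<=` measurable by move=> _ [s [A' [_ _ FA'] ->]]; exact: mfb.
have GF i : i != j -> F i `<=` G.
  move=> ij C FC; exists [:: i], (fun k => if k == i then C else setT) => //.
    split=> //; first by rewrite inE eq_sym.
    by move=> k; case: eqP => // ->.
  apply/seteqP; split=> w /=; last by move=> /(_ i); rewrite /= mem_head eqxx; apply.
  by move=> Cw k /=; rewrite inE => /eqP ->; rewrite eqxx.
have {}GA : <<s G >> A.
  move: A GA; apply: smallest_sub; first exact: smallest_sigma_algebra.
  move=> C [i /= ij FC]; apply: sub_sigma_algebra; exact: (GF i ij C FC).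
have PBfin : (0 <= fine (P B))%R by rewrite fine_ge0.
pose m2 := mscale (NngNum PBfin) P.
have m2E C : m2 C = (P B * P C)%E.
  by rewrite /m2 /mscale -[in RHS](@fineK _ (P B)) ?fin_num_measure.
have main := @g_sigma_algebra_measure_unique _ R T G mG (fun=> setT) _ _
  (mrestr P mB) m2 GI.
have -> : P (A `&` B) = mrestr P mB A by [].
rewrite main//.
- by apply: (etrans (m2E A)); rewrite muleC.
- by exists [::], (fun=> setT) => //; rewrite set_nil bigcap_set0.
- by apply: bigcup_const; exists 0%N.
- move=> _ [s [A' [us js FA'] ->]].
  apply/esym/(etrans (m2E _)); apply/esym; rewrite /mrestr.
  have mC := mfb s A' FA'.
  have mCB := measurableI _ _ mC mB.
  rewrite -[LHS]fineK ?fin_num_measure//.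
  rewrite -[P B]fineK ?fin_num_measure// -[X in (_ * X)%E]fineK ?fin_num_measure//.
  rewrite -EFinM; congr EFin.
  (* As j is not in s, [B] may occupy index j and the product rule applies to the list [j :: s]. *)
  pose A1 i := if i == j then B else A' i.
  have A1E i : i \in s -> A1 i = A' i.
    by move=> ii; rewrite /A1; case: eqP ii js => // -> ->.
  have E1 : \bigcap_(i in [set` s]) A' i `&` B = \bigcap_(i in [set` j :: s]) A1 i.
    rewrite !bigcap_seq big_cons /A1 eqxx setIC; congr (_ `&` _).
    by apply: eq_big_seq => i /A1E.
  transitivity (fine (P (\bigcap_(i in [set` j :: s]) A1 i))); first by rewrite -E1.
  rewrite (mutually_independent_seq indF)/=; last 2 first.
  - by rewrite js.
  - by move=> i _; rewrite /A1; case: eqP => // ->.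
  rewrite big_cons /A1 eqxx; congr (_ * _).
  rewrite -(@mutually_independent_seq _ F)//; last first.
    by move=> i ii; rewrite -/(A1 i) A1E.
  by congr (fine (P _)); apply: eq_bigcapr => i /= /A1E.
- by move=> k; rewrite /= /mrestr setTI ltey_eq fin_num_measure.
Qed.

(** The joint law equals the product of the marginals because both have the same values on
    rectangles; the right-hand side integrates the sections of [D]. *)
Lemma independent_RV_joint (X Y : {RV P >-> R}) (D : set (R * R)) :
  (forall A B : set R, measurable A -> measurable B ->
     P (X @^-1` A `&` Y @^-1` B) = (P (X @^-1` A) * P (Y @^-1` B))%E) ->
  measurable D ->
  P [set w | D (X w, Y w)] = (\int[P]_w P [set w' | D (X w, Y w')])%E.
Proof.
move=> ind mD.
have mXY : measurable_fun setT (fun w => (X w, Y w)).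
  exact: measurable_fun_pair.
pose XY : {mfun T >-> (R * R)%type} := mfun_Sub (mem_set mXY).
have H : (distribution P X \x distribution P Y)%E D = distribution P XY D.
  by apply: product_measure_unique => // A B mA mB; rewrite -ind.
transitivity (distribution P XY D); first by [].
rewrite -H /product_measure1 /= ge0_integral_distribution//; last first.
  exact: measurable_fun_xsection.
apply: eq_integral => w _ /=; rewrite /distribution /pushforward /=.
by congr (P _); apply/seteqP; split => w' /=; rewrite /xsection /= inE.
Qed.

End independence.

(** * Shadowed-Rician fading *)

Section truncated_exponential.
Context (R : realType).
Implicit Types x : R.

(** For x >= 0, [texp n x * expR (- x)] is the tail of the Gamma law of shape n + 1 and rate 1, that
    is, the regularised upper incomplete Gamma function. *)
Definition texp (n : nat) x : R := \sum_(v < n.+1) x ^+ v / v`!%:R.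

Lemma texp0 n : texp n 0 = 1.
Proof.
rewrite /texp big_ord_recl /= expr0 fact0 divr1 big1 ?addr0// => i _.
by rewrite expr0n mul0r.
Qed.

(** The derivative telescopes: each new term of the sum cancels the remainder left by the previous
    ones. *)
Lemma is_derive_texp_expRN n x :
  is_derive x 1 (fun y => texp n y * expR (- y))
    (- (x ^+ n / n`!%:R * expR (- x))).
Proof.
have De (y : R) : is_derive y 1 (fun z : R => expR (- z)) (- expR (- y)).
  have h : is_derive y 1 (-%R : R -> R) (-1) by exact: is_deriveNid.
  have := is_derive1_comp (is_derive_expR (- y)) h.
  by rewrite mulrN1.
elim: n => [|n ih].
  rewrite (_ : (fun y => texp 0 y * expR (- y)) = (fun y => expR (- y))).
    by rewrite expr0 fact0 divr1 mul1r; exact: De.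
  by apply/funext => y; rewrite /texp big_ord1 expr0 fact0 divr1 mul1r.
have Dx : is_derive x 1 (fun y : R => y ^+ n.+1) (n.+1%:R * x ^+ n).
  have h := @is_deriveX R R id n.+1 x 1 1 (is_derive_id _ _).
  rewrite -[X in is_derive _ _ X _](_ : id ^+ n.+1 = _); last first.
    by apply/funext => y; rewrite exprfctE.
  apply: (is_derive_eq h).
  by rewrite /GRing.scale /= mulr1.
rewrite (_ : (fun y => texp n.+1 y * expR (- y)) = ((fun y => texp n y * expR (- y)) \+
  ((n.+1)`!%:R^-1 \*: ((fun y => y ^+ n.+1) \* (fun y => expR (- y)))))); last first.
  apply/funext => y; rewrite /texp big_ord_recr /= mulrDl; congr (_ + _).
  by rewrite /GRing.scale /= mulrAC mulrC.
apply: (is_derive_eq (is_deriveD ih (is_deriveZ _ (is_deriveM Dx (De x))))).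
rewrite /GRing.scale /= factS natrM.
have n0 : n`!%:R != 0 :> R by rewrite pnatr_eq0 -lt0n fact_gt0.
have n1 : n.+1%:R != 0 :> R by rewrite pnatr_eq0.
rewrite exprS; field.
by rewrite n0 addrC natr1 n1.
Qed.

Lemma continuous_texp_expRN n : continuous (fun y : R => texp n y * expR (- y)).
Proof.
move=> x; apply: differentiable_continuous; apply/derivable1_diffP.
by have [] := is_derive_texp_expRN n x.
Qed.

Lemma cvg_texp_expRN n : (texp n x * expR (- x)) @[x --> +oo] --> (0 : R).
Proof.
rewrite /texp.
have H v : (x ^+ v / v`!%:R * expR (- x)) @[x --> +oo] --> (0 : R).
  (* The majorant (v + 1) / x comes from e^x >= x^(v+1) / (v+1)!, one power more than the
     numerator. *)
  have l1 : (v.+1%:R * x^-1) @[x --> +oo] --> (0 : R).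
    rewrite -[X in _ --> X](mulr0 v.+1%:R); apply: cvgMl_tmp.
    by apply/gtr0_cvgV0; [exact: nbhs_pinfty_gt|exact: cvg_id].
  apply: (squeeze_cvgr _ (cvg_cst 0) l1).
    near=> x.
    have x0 : 0 < x by [].
    rewrite /= mulr_ge0 ?divr_ge0 ?expR_ge0 ?exprn_ge0 ?(ltW x0)//=.
    rewrite expRN ler_pdivrMr ?expR_gt0//.
    have := expR_ge1Dxn v (ltW x0).
    rewrite factS natrM => h.
    have n0 : v`!%:R != 0 :> R by rewrite pnatr_eq0 -lt0n fact_gt0.
    have n1 : v.+1%:R != 0 :> R by rewrite pnatr_eq0.
    have xn0 : x != 0 by rewrite gt_eqF.
    have v1 : 0 < v.+1%:R :> R by rewrite ltr0n.
    rewrite (_ : x ^+ v / _ = v.+1%:R / x * (x ^+ v.+1 / (v.+1%:R * v`!%:R))).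
      rewrite ler_pM2l ?divr_gt0//.
      by apply: le_trans h; rewrite lerDr.
    rewrite exprS; field.
    by rewrite n0 xn0 addrC natr1 n1.
elim: n => [|n ih].
  by under eq_fun do rewrite big_ord1; exact: H.
under eq_fun do rewrite big_ord_recr mulrDl.
have := cvgD ih (H n.+1); rewrite addr0; apply.
Unshelve. all: by end_near. Qed.

End truncated_exponential.
Section gamma_nat.
Context (R : realType).

(** The truncated exponential supplies the antiderivative [F] of t^n e^(-t); it is - n! at 0 and
    tends to 0 at infinity. *)
Lemma Gamma_nat n : Gamma n.+1%:R = n`!%:R :> R.
Proof.
have n0 : n`!%:R != 0 :> R by rewrite pnatr_eq0 -lt0n fact_gt0.
pose f (t : R) : R := t ^+ n * expR (- t).
pose F (t : R) : R := - n`!%:R * (texp n t * expR (- t)).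
have cf : continuous f.
  move=> x; apply: cvgM; first exact: exprn_continuous.
  by apply: continuous_comp; [exact: opp_continuous|exact: continuous_expR].
have dF (x : R) : is_derive x 1 F (f x).
  apply: (is_derive_eq (is_deriveZ (- n`!%:R) (is_derive_texp_expRN n x))).
  by rewrite /GRing.scale /= /f; field.
have cF : continuous F.
  move=> x; apply: differentiable_continuous; apply/derivable1_diffP.
  by have [] := dF x.
rewrite /Gamma.
have mf A : measurable A -> measurable_fun A f.
  by move=> mA; apply: measurable_funTS; exact: continuous_measurable_fun.
transitivity (\int[lebesgue_measure]_(t in `]0%R, +oo[) f t).
  rewrite /Rintegral; congr fine; apply: eq_integral => t.
  rewrite inE /= in_itv /= andbT => t0.
  by rewrite -(natr1 n) addrK powR_mulrn// ltW.
rewrite /Rintegral integral_itv_obnd_cbnd; last first.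
  by apply/measurable_EFinP; exact: mf.
rewrite (@ge0_continuous_FTC2y _ f F 0 0).
- by rewrite /F texp0 oppr0 expR0 mul1r mulr1 -EFinB /= opprK add0r.
- by move=> x x0; rewrite /f mulr_ge0 ?exprn_ge0 ?expR_ge0.
- exact: continuous_subspaceT.
- rewrite -[X in _ --> X](mulr0 (- n`!%:R)); apply: cvgMl_tmp.
  exact: cvg_texp_expRN.
- by move=> x _; have [] := dF x.
- exact/cvg_at_right_filter/cF.
- by move=> x _; rewrite derive1E; have [] := dF x.
Qed.

End gamma_nat.

(** * Kummer's transformation for a positive integer parameter *)

Section kummer.
Context (R : realType).

Lemma pochhammer1E k : pochhammer 1 k = k`!%:R :> R.
Proof.
elim: k => [|k ih]; first by rewrite /pochhammer big_ord0.
rewrite /pochhammer big_ord_recr /= -/(pochhammer 1 k) ih factS.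
by rewrite mulnC natrM addrC natr1.
Qed.

Lemma pochhammer_nat n k :
  pochhammer n.+1%:R k * n`!%:R = (n + k)`!%:R :> R.
Proof.
elim: k => [|k ih]; first by rewrite /pochhammer big_ord0 mul1r addn0.
rewrite /pochhammer big_ord_recr /= -/(pochhammer _ k) mulrAC ih addnS factS.
by rewrite mulnC natrM -natrD addSn.
Qed.

(** The sign (-1)^z cancels the one written in [zeta], so all mixture weights are positive. *)
Lemma pochhammer_opp n z : (z <= n)%N ->
  pochhammer (1 - n.+1%:R) z = (-1) ^+ z * (n ^_ z)%:R :> R.
Proof.
elim: z => [|z ih] zn; first by rewrite /pochhammer big_ord0 ffactn0 expr0 mulr1.
rewrite /pochhammer big_ord_recr /= -/(pochhammer _ z) ih ?(ltnW zn)//.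
rewrite ffactnSr natrM natrB ?(ltnW zn)// exprS -(natr1 n).
by ring.
Qed.

(* Kummer's transformation 1F1(n+1; 1; x) = e^x 1F1(-n; 1; -x), whose right-hand
   side is a finite sum; here it is Vandermonde's identity
   'C(n + k, k) = \sum_j 'C(n, j) 'C(k, j) read on the power series. *)
Lemma hyp1F1_nat n (x : R) :
  hyp1F1 n.+1%:R 1 x = expR x * \sum_(j < n.+1) 'C(n, j)%:R * x ^+ j / j`!%:R.
Proof.
have fn0 k : k`!%:R != 0 :> R by rewrite pnatr_eq0 -lt0n fact_gt0.
(* [g j] is the exponential series delayed by j places. Its partial sums still tend to e^x, so the
   double sum becomes a finite combination of convergent series. *)
pose g (j k : nat) : R := if (j <= k)%N then exp_coeff x (k - j)%N else 0.
have gE j N : series (g j) (N + j)%N = series (exp_coeff x) N.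
  rewrite /series /= (big_cat_nat (n := j)) //= ?leq_addl//.
  rewrite big_nat big1 ?add0r; last first.
    by move=> i /andP[_ ij]; rewrite /g leqNgt ij.
  rewrite -{1}[j]add0n big_addn addnK; apply: eq_bigr => i _.
  by rewrite /g leq_addl addnK.
have gcvg j : series (g j) @ \oo --> expR x.
  rewrite -(cvg_shiftn j).
  rewrite (_ : [sequence _]_ _ = series (exp_coeff x)); last first.
    by apply/funext => N /=; rewrite gE.
  exact: is_cvg_series_exp_coeff.
have termE k : pochhammer n.+1%:R k / pochhammer 1 k * x ^+ k / k`!%:R =
    \sum_(j < n.+1) ('C(n, j)%:R * x ^+ j / j`!%:R) * g j k.
  have -> : pochhammer n.+1%:R k / pochhammer 1 k = 'C(n + k, n)%:R :> R.
    rewrite pochhammer1E; apply: (mulIf (fn0 k)); apply: (mulIf (fn0 n)).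
    rewrite divfK// pochhammer_nat -(@bin_fact (n + k) n) ?leq_addr// addKn.
    by rewrite !natrM; ring.
  rewrite -binomial.Vandermonde (reindex_inj rev_ord_inj) /=.
  rewrite natr_sum !mulr_suml; apply: eq_bigr => i _.
  have in_ : (i <= n)%N by rewrite -ltnS.
  rewrite subSS bin_sub// subKn// /g; case: leqP => ik; last first.
    by rewrite (bin_small ik) muln0 !mul0r mulr0.
  rewrite -{1 2}(subnKC ik) natrM exprD.
  have -> : k`!%:R = 'C(k, i)%:R * (i`!%:R * (k - i)`!%:R) :> R.
    by rewrite -!natrM bin_fact.
  have c0 : 'C(k, i)%:R != 0 :> R by rewrite pnatr_eq0 -lt0n bin_gt0.
  by rewrite /exp_coeff /= subnKC//; field; rewrite c0 !fn0.
rewrite /hyp1F1; apply/cvg_lim => //.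
rewrite (_ : series _ = (fun N => \sum_(j < n.+1)
    ('C(n, j)%:R * x ^+ j / j`!%:R) * series (g j) N)); last first.
  apply/funext => N; rewrite /series /=.
  under eq_bigr do rewrite termE.
  by rewrite exchange_big; apply: eq_bigr => j _; rewrite mulr_sumr.
rewrite mulrC mulr_suml; elim: n.+1 => [|m ih].
  by under eq_fun do rewrite big_ord0; rewrite big_ord0; exact: cvg_cst.
under eq_fun do rewrite big_ord_recr; rewrite big_ord_recr.
by apply: cvgD; [exact: ih|apply: cvgMl_tmp; exact: gcvg].
Qed.

End kummer.
Section shadowed_rician.
Context (R : realType) (p : params R).
Hypothesis pv : valid_params p.

Lemma sr_den_gt0 : 0 < 2 * sr_b p * (m_s p)%:R + sr_Omega p.
Proof.
have := sr_b_gt0 pv; have := sr_Omega_gt0 pv; have := m_s_gt0 pv.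
by move=> m0 O0 b0; rewrite addr_gt0// !mulr_gt0// ltr0n.
Qed.

(** The difference collapses to m_s / (2 b m_s + Omega), the common rate of the Gamma components. *)
Lemma beta_cc_gt0 : 0 < beta p - cc p.
Proof.
have b0 := sr_b_gt0 pv; have m0 := m_s_gt0 pv.
have D0 := sr_den_gt0.
rewrite (_ : beta p - cc p =
  (m_s p)%:R / (2 * sr_b p * (m_s p)%:R + sr_Omega p)).
  by rewrite divr_gt0// ltr0n.
rewrite /beta /cc; field.
by rewrite !gt_eqF// addr_gt0.
Qed.

(** Mixture of the distribution functions of Gamma laws of shape z + 1 and rate beta - c. It is the
    distribution function of the fading power only for t >= 0. *)
Definition sr_cdf (t : R) : R :=
  \sum_(z < m_s p) zeta p z * Gamma z.+1%:R / (beta p - cc p) ^+ z.+1 *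
    (1 - texp z ((beta p - cc p) * t) * expR (- ((beta p - cc p) * t))).

Definition sr_density (x : R) : R :=
  \sum_(z < m_s p) zeta p z * (2 * x ^+ (2 * z).+1 *
    expR (- ((beta p - cc p) * x ^+ 2))).

(** Kummer's factor e^(c x^2) merges with e^(- beta x^2), which leaves a polynomial times one
    exponential. *)
Lemma shadowed_ricianE (x : R) : shadowed_rician p x = sr_density x.
Proof.
have b0 : sr_b p != 0 by rewrite gt_eqF// (sr_b_gt0 pv).
have D0 : 2 * sr_b p * (m_s p)%:R + sr_Omega p != 0 by rewrite gt_eqF// sr_den_gt0.
rewrite /shadowed_rician /sr_density /zeta.
set K := (_ / _) ^+ m_s p; set y := sr_Omega p * _ / _.
have yE : y = cc p * x ^+ 2.
  by rewrite /y /cc; field; rewrite D0 b0.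
have -> : expR (- ((beta p - cc p) * x ^+ 2)) = expR (- (x ^+ 2 / (2 * sr_b p))) * expR y.
  rewrite -expRD yE; congr expR; rewrite /beta; field.
  by rewrite b0.
rewrite -mulrA -!mulrA; move: (expR (- _)) => e.
have -> : hyp1F1 (m_s p)%:R 1 y = expR y * \sum_(j < m_s p) 'C((m_s p).-1, j)%:R * y ^+ j / j`!%:R.
  by rewrite -[in LHS](prednK (m_s_gt0 pv)) hyp1F1_nat prednK ?(m_s_gt0 pv).
rewrite !mulr_sumr; apply: eq_bigr => i _.
have fi : i`!%:R != 0 :> R by rewrite pnatr_eq0 -lt0n fact_gt0.
have := @pochhammer_opp R (m_s p).-1 i.
rewrite prednK ?(m_s_gt0 pv)// => ->; last by rewrite -ltnS prednK ?(m_s_gt0 pv).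
rewrite -bin_ffact natrM yE exprMn -exprM (exprS x (2 * i)) /beta.
by rewrite -[(-1) ^+ i]signr_odd; case: (odd i); rewrite ?expr0 ?expr1; field;
  rewrite fi b0.
Qed.

(** The square appears because the given density is that of the square root of the fading power. *)
Lemma is_derive_sr_cdf (x : R) :
  is_derive x 1 (fun y => sr_cdf (y ^+ 2)) (sr_density x).
Proof.
have a0 : beta p - cc p != 0 by rewrite gt_eqF// beta_cc_gt0.
set a := beta p - cc p in a0 *.
have Dq : is_derive x 1 (fun y : R => a * y ^+ 2) (a * (2 * x)).
  have h := @is_deriveX R R id 2 x 1 1 (is_derive_id _ _).
  have h' := is_deriveZ a h.
  rewrite -[X in is_derive _ _ X _](_ : a \*: (id ^+ 2) = _); last first.
    by apply/funext => y; rewrite exprfctE.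
  by apply: (is_derive_eq h'); rewrite /GRing.scale /= mulr1 expr1.
pose h (z : 'I_(m_s p)) (y : R) := zeta p z * Gamma z.+1%:R / a ^+ z.+1 *
  (1 - texp z (a * y ^+ 2) * expR (- (a * y ^+ 2))).
rewrite (_ : (fun y => _) = \sum_(z < m_s p) h z); last first.
  by apply/funext => y; rewrite fct_sumE.
apply: is_derive_sum => z.
have D1 := @is_derive1_comp R (fun y => texp z y * expR (- y))
  (fun y => a * y ^+ 2) x _ _ (is_derive_texp_expRN z (a * x ^+ 2)) Dq.
have D2 := is_deriveZ (zeta p z * Gamma z.+1%:R / a ^+ z.+1)
  (is_deriveB (is_derive_cst (1 : R) x 1) D1).
apply: (is_derive_eq D2).
rewrite /GRing.scale /= Gamma_nat.
have fi : z`!%:R != 0 :> R by rewrite pnatr_eq0 -lt0n fact_gt0.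
rewrite exprMn -exprM exprS [_ ^+ (2 * z).+1]exprS; field.
by rewrite fi a0 expf_neq0.
Qed.

Lemma continuous_sr_density : continuous sr_density.
Proof.
move=> x; rewrite /sr_density; elim: (m_s p) => [|m ih].
  by under eq_fun do rewrite big_ord0; exact: cvg_cst.
under eq_fun do rewrite big_ord_recr.
apply: cvgD; first exact: ih.
apply: cvgM; first exact: cvg_cst.
apply: cvgM.
  by apply: cvgM; [exact: cvg_cst|exact: exprn_continuous].
apply: continuous_cvg; first exact: continuous_expR.
apply: cvgN; apply: cvgM; first exact: cvg_cst.
exact: exprn_continuous.
Qed.

Lemma sr_cdf0 : sr_cdf 0 = 0.
Proof.
rewrite /sr_cdf big1// => z _.
by rewrite mulr0 texp0 oppr0 expR0 mul1r subrr mulr0.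
Qed.

Lemma measurable_sr_cdf : measurable_fun setT sr_cdf.
Proof.
apply: measurable_sum => z; apply: measurable_funM; first exact: measurable_cst.
apply: measurable_funB; first exact: measurable_cst.
apply: (@measurableT_comp _ _ _ _ _ _ (fun y : R => texp z y * expR (- y)) _
  (fun t => (beta p - cc p) * t)).
  by apply: continuous_measurable_fun; exact: continuous_texp_expRN.
by apply: measurable_funM.
Qed.

(** Through the complement, only an integral over the bounded interval ]0, sqrt t] has to be
    computed, by the antiderivative [sr_cdf (y ^+ 2)]. *)
Lemma sr_ccdf d (T : measurableType d) (P : probability T R) (H : {RV P >-> R})
    (t : R) :
  has_density_pos P (fun w => Num.sqrt (H w)) (shadowed_rician p) -> 0 <= t ->
  P [set w | t < H w] = (1 - sr_cdf t)%:E.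
Proof.
move=> Hd t0.
have mH : measurable [set w | t < H w].
  rewrite (_ : [set w | _] = H @^-1` `]t, +oo[).
    by rewrite -[X in measurable X]setTI; exact: measurable_funP.
  by apply/seteqP; split => w /=; rewrite in_itv/= andbT.
rewrite -[LHS]fineK ?fin_num_measure//.
have -> : [set w | t < H w] = ~` [set w | H w <= t].
  by apply/seteqP; split => w /=; rewrite ltNge => /negP.
have mH' : measurable [set w | H w <= t].
  rewrite (_ : [set w | _] = H @^-1` `]-oo, t]).
    by rewrite -[X in measurable X]setTI; exact: measurable_funP.
  by apply/seteqP; split => w /=; rewrite in_itv/=.
rewrite probability_setC// fineK ?fin_numB ?fin_num_measure//.
rewrite EFinB; congr (_ - _)%E.
(* This holds even where H is negative: [Num.sqrt] sends negative numbers to 0, and t >= 0. *)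
have -> : [set w | H w <= t] = (fun w => Num.sqrt (H w)) @^-1` `]-oo, Num.sqrt t].
  by apply/seteqP; split => w /=; rewrite in_itv/= ler_sqrt.
rewrite Hd//.
have -> : `]-oo, Num.sqrt t] `&` `]0, +oo[ = `]0, Num.sqrt t]%classic.
  apply/seteqP; split => x /=; rewrite !in_itv/= ?andbT.
    by move=> [-> ->].
  by move=> /andP[-> ->].
under eq_integral do rewrite shadowed_ricianE.
have := sqrtr_ge0 t; rewrite le_eqVlt => /predU1P[s0|s0].
  rewrite -s0 set_itv_ge ?bnd_simp ?ltxx// integral_set0.
  move/esym/eqP: s0; rewrite sqrtr_eq0 => t0'.
  by rewrite (_ : t = 0) ?sr_cdf0//; apply/eqP; rewrite eq_le t0 t0'.
rewrite integral_itv_obnd_cbnd; last first.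
  apply/measurable_EFinP; apply: measurable_funTS.
  by apply: continuous_measurable_fun; exact: continuous_sr_density.
have cF : continuous (fun y : R => sr_cdf (y ^+ 2)).
  move=> x; apply: differentiable_continuous; apply/derivable1_diffP.
  by have [] := is_derive_sr_cdf x.
rewrite (@continuous_FTC2 _ sr_density (fun y => sr_cdf (y ^+ 2)))//.
- by rewrite sqr_sqrtr// expr0n sr_cdf0 sube0.
- by apply: continuous_subspaceT; exact: continuous_sr_density.
- split=> [x _||]; first by have [] := is_derive_sr_cdf x.
    exact/cvg_at_right_filter/cF.
  exact/cvg_at_left_filter/cF.
- by move=> x _; rewrite derive1E; have [] := is_derive_sr_cdf x.
Qed.

(** Nonpositive powers have square root 0, a value outside the half-line ]0, +oo[ that carries the
    law. *)
Lemma fading_le0_null d (T : measurableType d) (P : probability T R) (H : {RV P >-> R})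
    (g : R -> R) :
  has_density_pos P (fun w => Num.sqrt (H w)) g ->
  P [set w | H w <= 0] = 0%E.
Proof.
move=> Hd.
have -> : [set w | H w <= 0] = (fun w => Num.sqrt (H w)) @^-1` [set 0].
  apply/seteqP; split => w /=; first by move=> ?; rewrite ler0_sqrtr.
  by move/eqP; rewrite sqrtr_eq0.
rewrite Hd// (_ : _ `&` _ = set0) ?integral_set0//.
by rewrite -subset0 => x /= [->]; rewrite in_itv/= ltxx.
Qed.

End shadowed_rician.

(** * Spherical geometry and Poisson processes *)

Section geometry.
Context (R : realType).
Implicit Types (x y u : R * R * R) (rho r : R).

Lemma dot3_ge0 x : 0 <= dot3 x x.
Proof. by rewrite /dot3 !addr_ge0// -expr2 sqr_ge0. Qed.

Lemma dist3_ge0 x y : 0 <= dist3 x y.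
Proof. exact: sqrtr_ge0. Qed.

Lemma dist3_sq x y : dist3 x y ^+ 2 =
  (x.1.1 - y.1.1) ^+ 2 + (x.1.2 - y.1.2) ^+ 2 + (x.2 - y.2) ^+ 2.
Proof. by rewrite /dist3 sqr_sqrtr ?dot3_ge0// /dot3 /= -!expr2. Qed.

Lemma measurable_dist3 u : measurable_fun [set: R * R * R] (fun x => dist3 x u).
Proof.
have ms : measurable_fun [set: R] Num.sqrt.
  by apply: continuous_measurable_fun; exact: sqrt_continuous.
rewrite /dist3; apply: (measurableT_comp ms).
rewrite /dot3 /=.
have m1 : measurable_fun [set: R * R * R] (fun x => x.1.1).
  exact: (measurableT_comp measurable_fst measurable_fst).
have m2 : measurable_fun [set: R * R * R] (fun x => x.1.2).
  exact: (measurableT_comp measurable_snd measurable_fst).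
have m3 : measurable_fun [set: R * R * R] (fun x => x.2) by exact: measurable_snd.
by apply: measurable_funD; [apply: measurable_funD|]; apply: measurable_funM;
  apply: measurable_funD.
Qed.

Lemma measurable_sphere3 rho : measurable (sphere3 rho : set (R * R * R)).
Proof.
rewrite (_ : sphere3 rho = (fun x => dist3 x 0) @^-1` [set rho]).
  by rewrite -[X in measurable X]setTI; exact: measurable_dist3.
by apply/seteqP; split.
Qed.

Lemma measurable_closed_ball3 u r : measurable [set x | dist3 x u <= r].
Proof.
rewrite (_ : [set x | _] = (fun x => dist3 x u) @^-1` `]-oo, r]).
  by rewrite -[X in measurable X]setTI; exact: measurable_dist3.
by apply/seteqP; split => x /=; rewrite in_itv.
Qed.

(** The plane is given as an image, from which measurability cannot be read off. Orthonormality
    makes it the set of fixed points of the projection [proj], an equation between measurable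
    coordinates. *)
Lemma measurable_disc u (f1 f2 : R * R * R) rho :
  dot3 f1 f1 = 1 -> dot3 f2 f2 = 1 -> dot3 f1 f2 = 0 ->
  measurable (disc u f1 f2 rho).
Proof.
move=> f11 f22 f12; apply: measurableI; last exact: measurable_closed_ball3.
have m1 : measurable_fun [set: R * R * R] (fun x => x.1.1).
  exact: (measurableT_comp measurable_fst measurable_fst).
have m2 : measurable_fun [set: R * R * R] (fun x => x.1.2).
  exact: (measurableT_comp measurable_snd measurable_fst).
have m3 : measurable_fun [set: R * R * R] (fun x => x.2) by exact: measurable_snd.
have md f : measurable_fun [set: R * R * R] (fun x => dot3 (x - u) f).
  by rewrite /dot3 /=; apply: measurable_funD; [apply: measurable_funD|];
    apply: measurable_funM => //; apply: measurable_funD.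
pose proj x := plane_param u f1 f2 (dot3 (x - u) f1, dot3 (x - u) f2).
rewrite (_ : range _ = [set x | x.1.1 - (proj x).1.1 = 0] `&`
    [set x | x.1.2 - (proj x).1.2 = 0] `&` [set x | x.2 - (proj x).2 = 0]).
  have mz (g : R * R * R -> R) : measurable_fun setT g -> measurable [set x | g x = 0].
    move=> mg; rewrite (_ : [set x | _] = g @^-1` [set 0])//.
    by rewrite -[X in measurable X]setTI; exact: mg.
  apply: measurableI; [apply: measurableI|]; apply: mz; rewrite /proj /=;
    apply: measurable_funB => //; apply: measurable_funD => //;
    by apply: measurable_funD; apply: measurable_funM.
apply/seteqP; split => [_ [[a b] _ <-]|[[x1 x2] x3] [[/= /eqP h1 /eqP h2] /eqP h3]].
  rewrite /proj /=.
  have -> : dot3 (plane_param u f1 f2 (a, b) - u) f1 = a.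
    transitivity (a * dot3 f1 f1 + b * dot3 f1 f2); last by rewrite f11 f12; ring.
    by rewrite /dot3 /plane_param /= /GRing.scale /=; ring.
  have -> : dot3 (plane_param u f1 f2 (a, b) - u) f2 = b.
    transitivity (a * dot3 f1 f2 + b * dot3 f2 f2); last by rewrite f22 f12; ring.
    by rewrite /dot3 /plane_param /= /GRing.scale /=; ring.
  by rewrite /= !subrr.
move: h1 h2 h3; set a := dot3 _ f1; set b := dot3 _ f2; rewrite !subr_eq0.
move=> /eqP h1 /eqP h2 /eqP h3; exists (a, b) => //.
rewrite [LHS](surjective_pairing (plane_param u f1 f2 (a, b))).
rewrite [X in (X, _)](surjective_pairing (plane_param u f1 f2 (a, b)).1).
by rewrite /plane_param /= -h1 -h2 -h3.
Qed.

End geometry.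

Section areas.
Context (R : realType).

Lemma integral_setX_fst (A B : set R) (g : R -> R) :
  measurable A -> measurable B -> measurable_fun setT g ->
  (forall t, A t -> 0 <= g t) ->
  (\int[lebesgue_measure \x lebesgue_measure]_(a in A `*` B) (g a.1)%:E =
   (\int[lebesgue_measure]_(t in A) (g t)%:E) * lebesgue_measure B)%E.
Proof.
move=> mA mB mg g0.
pose h (a : R * R) : \bar R := (g a.1 * (\1_A a.1 * \1_B a.2))%:E.
have hE : (fun a : R * R => ((g a.1)%:E)) \_ (A `*` B) = h.
  apply/funext => -[s t]; rewrite patchE /h /= in_setX /= !indicE.
  by case: (s \in A); case: (t \in B); rewrite /= ?mulr1 ?mulr0.
have mh : measurable_fun setT h.
  apply/measurable_EFinP; apply: measurable_funM.
    exact: (measurableT_comp mg measurable_fst).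
  apply: measurable_funM.
    exact: (measurableT_comp (measurable_indic mA) measurable_fst).
  exact: (measurableT_comp (measurable_indic mB) measurable_snd).
have h0 a : (0 <= h a)%E.
  rewrite /h lee_fin !indicE; case: (boolP (a.1 \in A)) => [/set_mem Aa|_].
    by rewrite !mulr_ge0// g0.
  by rewrite mul0r mulr0.
rewrite integral_mkcond hE fubini_tonelli1//.
have E s : fubini_F lebesgue_measure h s =
    ((g s * \1_A s)%:E * lebesgue_measure B)%E.
  rewrite /fubini_F /h /=.
  under eq_integral do rewrite mulrA EFinM.
  rewrite ge0_integralZl//=.
  - by rewrite integral_indic// setIT.
  - by apply/measurable_EFinP; exact: measurable_indic.
  - rewrite lee_fin indicE; case: (boolP (s \in A)) => [/set_mem As|_].
      by rewrite mulr1 g0.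
    by rewrite mulr0.
transitivity (\int[lebesgue_measure]_s
    ((g s * \1_A s)%:E * lebesgue_measure B))%E.
  by apply: eq_integral => s _; exact: E.
rewrite ge0_integralZr//.
- rewrite [in RHS]integral_mkcond; congr (_ * _)%E; apply: eq_integral => s _.
  by rewrite patchE indicE; case: (s \in A); rewrite ?mulr1 ?mulr0.
- apply/measurable_EFinP; apply: measurable_funM => //; exact: measurable_indic.
- move=> s _; rewrite lee_fin indicE; case: (boolP (s \in A)) => [/set_mem As|_].
    by rewrite mulr1 g0.
  by rewrite mulr0.
Qed.

Lemma sphere_param_in (rho : R) (a : R * R) : 0 <= rho ->
  sphere3 rho (sphere_param rho a).
Proof.
move=> r0; rewrite /sphere3 /=; apply/eqP; rewrite -(eqrXn2 (n := 2))//; last first.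
  exact: dist3_ge0.
rewrite dist3_sq /= !subr0; apply/eqP.
transitivity (rho ^+ 2 * (sin a.1 ^+ 2 * (cos a.2 ^+ 2 + sin a.2 ^+ 2) + cos a.1 ^+ 2)).
  by ring.
by rewrite cos2Dsin2 mulr1 [sin _ ^+ 2 + _]addrC cos2Dsin2 mulr1.
Qed.

(** For a set invariant under rotation about the axis, the azimuth contributes the factor 2 pi. *)
Lemma sphere_area_polar (rho : R) (B : set (R * R * R)) (A : set R) :
  measurable A -> A `<=` `[0, pi]%classic ->
  (forall a, a.1 \in `[0, pi] -> B (sphere_param rho a) <-> A a.1) ->
  sphere_area rho B = ((2 * pi)%:E *
    \int[lebesgue_measure]_(t in A) (rho ^+ 2 * sin t)%:E)%E.
Proof.
move=> mA Api BA.
rewrite /sphere_area (_ : _ `&` _ = A `*` `[0, 2 * pi]%classic); last first.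
  apply/seteqP; split => -[s t] /=; rewrite /sphere_chart /=.
    by move=> [[s0 t0] Bst]; split => //; apply/(BA (s, t)).
  move=> [As t0]; have s0 := Api _ As.
  by split => //; apply/BA.
rewrite (@integral_setX_fst _ _ (fun t => rho ^+ 2 * sin t))//.
- by rewrite lebesgue_measure_itv /= lte_fin mulr_gt0 ?pi_gt0// sube0 muleC.
- apply: measurable_funM => //; apply: continuous_measurable_fun.
  exact: continuous_sin.
- move=> t /Api; rewrite /= in_itv /= => /andP[t0 tpi].
  by rewrite mulr_ge0 ?sqr_ge0// sin_ge0_pi// t0.
Qed.

Lemma sphere_area_cap (rho th : R) (B : set (R * R * R)) :
  0 <= th <= pi ->
  (forall a, a.1 \in `[0, pi] -> B (sphere_param rho a) <-> a.1 <= th) ->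
  sphere_area rho B = (2 * pi * rho ^+ 2 * (1 - cos th))%:E.
Proof.
move=> /andP[th0 thpi] Bth.
rewrite (@sphere_area_polar _ _ `[0, th]%classic)//; last 2 first.
- by apply: subset_itvl; rewrite bnd_simp.
- move=> a api; rewrite Bth//= in_itv /=; move: api; rewrite in_itv /= => /andP[-> _].
  by [].
move: th0; rewrite le_eqVlt => /predU1P[<-|th0].
  by rewrite set_itv1 integral_set1 cos0 subrr mulr0 mule0.
rewrite (@continuous_FTC2 _ _ (fun t => - (rho ^+ 2 * cos t)))//.
- by rewrite cos0 -EFinB -EFinM; congr EFin; ring.
- apply: continuous_subspaceT => x; apply: cvgM; first exact: cvg_cst.
  exact: continuous_sin.
- have c : continuous (fun t : R => - (rho ^+ 2 * cos t)).
    by move=> x; apply: cvgN; apply: cvgM; [exact: cvg_cst|exact: continuous_cos].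
  split; [|exact/cvg_at_right_filter/c|exact/cvg_at_left_filter/c].
  by move=> x _; apply: derivableN; apply: derivableM.
- move=> x _; rewrite derive1E.
  have h := is_deriveN (is_deriveZ (rho ^+ 2) (is_derive_cos x)).
  have [_] := h.
  rewrite /GRing.scale /= mulrN opprK => <-.
  by [].
Qed.

(** Bounding the sine by 1 suffices: ties only require an area at most linear in the angular
    width. *)
Lemma sphere_area_slice (rho s t : R) (B : set (R * R * R)) :
  0 <= s -> s <= t -> t <= pi ->
  (forall a, a.1 \in `[0, pi] -> B (sphere_param rho a) <-> s <= a.1 < t) ->
  (sphere_area rho B <= (2 * pi * rho ^+ 2 * (t - s))%:E)%E.
Proof.
move=> s0 st tpi Bst.
rewrite (@sphere_area_polar _ _ `[s, t[%classic)//; last first.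
  by move=> x; rewrite /= !in_itv /= => /andP[sx xt]; rewrite (le_trans s0)//= (le_trans (ltW xt)).
rewrite -mulrA [leRHS]EFinM lee_pmul2l ?fin_numE// ?lte_fin ?mulr_gt0 ?pi_gt0//.
apply: (@le_trans _ _ (\int[lebesgue_measure]_(x in `[s, t[) (rho ^+ 2)%:E)%E).
  apply: ge0_le_integral => //.
  - move=> x; rewrite /= in_itv /= => /andP[sx xt].
    by rewrite lee_fin mulr_ge0 ?sqr_ge0// sin_ge0_pi// (le_trans s0)//= (le_trans (ltW xt)).
  - apply/measurable_EFinP; apply: measurable_funM => //.
    by apply: measurable_funTS; apply: continuous_measurable_fun; exact: continuous_sin.
  - by move=> x _; rewrite lee_fin ler_piMr ?sqr_ge0// sin_le1.
rewrite integral_cst//= lebesgue_measure_itv /= lte_fin.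
case: ltP => ts; first by rewrite -EFinB -EFinM.
by rewrite mule0 lee_fin mulr_ge0 ?sqr_ge0// subr_ge0.
Qed.

End areas.

(** * Poisson probabilities of no point and of several points *)

Section poisson_bounds.
Context (R : realType).

Lemma poisson_prob_0 (q : R) : 0 <= q ->
  poisson_prob q 0%N [set 0%N] = (expR (- q))%:E.
Proof.
rewrite le_eqVlt => /predU1P[<-|q0]; rewrite /poisson_prob.
  by rewrite ltxx oppr0 expR0 diracE mem_set.
rewrite q0 esum_set1 ?lee_fin ?poisson_pmf_ge0// /poisson_pmf q0.
by rewrite expr0 fact0 invr1 mulr1 mul1r.
Qed.

(** For q > 0 this is 1 - (1 + q) e^(-q) <= 1 - (1 + q)(1 - q) = q^2. For q <= 0 [poisson_prob] is
    the Dirac mass at 0. *)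
Lemma poisson_prob_ge2 (q : R) :
  (poisson_prob q 0%N [set n | (2 <= n)%N] <= (q ^+ 2)%:E)%E.
Proof.
case: (ltP 0 q) => q0; last first.
  rewrite /poisson_prob ltNge q0 /= diracE memNset// lee_fin.
  exact: sqr_ge0.
have -> : [set n | (2 <= n)%N] = ~` ([set 0%N] `|` [set 1%N]).
  apply/seteqP; split => [n /= n2 [] n0|[|[|n]]] //=.
  - by rewrite n0 in n2.
  - by rewrite n0 in n2.
  - by move=> h; exfalso; apply: h; left.
  - by move=> h; exfalso; apply: h; right.
have := @probability_setC _ nat R (poisson_prob q 0%N) ([set 0%N] `|` [set 1%N]) I.
move=> ->.
rewrite measureU//; last by rewrite -subset0 => n /= [->].
have E0 : poisson_prob q 0%N [set 0%N] = (expR (- q))%:E.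
  by apply: poisson_prob_0; exact: ltW.
have E1 : poisson_prob q 0%N [set 1%N] = (q * expR (- q))%:E.
  rewrite /poisson_prob q0 esum_set1 ?lee_fin ?poisson_pmf_ge0// /poisson_pmf q0.
  by rewrite expr1 invr1 mulr1.
rewrite [X in (_ - (X + _))%E]E0 [X in (_ - (_ + X))%E]E1.
rewrite -EFinD lee_fin.
have := expR_ge1Dx (- q).
by nra.
Qed.

End poisson_bounds.

(** * Measurability of random indices and random sums *)

Section random_sums.
Context d (T : measurableType d) (R : realType).

Lemma measurable_fun_random_index d' (T' : measurableType d')
    (F : nat -> T -> T') (np : T -> nat) :
  measurable_fun setT np -> (forall n, measurable_fun setT (F n)) ->
  measurable_fun setT (fun w => F (np w) w).
Proof.
move=> mnp mF _ B mB; rewrite setTI.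
rewrite (_ : _ @^-1` _ = \bigcup_n (np @^-1` [set n] `&` F n @^-1` B)).
  apply: bigcupT_measurable => n; apply: measurableI; rewrite -[X in measurable X]setTI.
    exact: mnp.
  exact: mF.
apply/seteqP; split => [w /= Bw|w [n _ [/= <-]]]//.
by exists (np w).
Qed.

Lemma measurable_random_sum (b : nat -> T -> bool) (F : nat -> T -> R)
    (np : T -> nat) :
  measurable_fun setT np -> (forall n, measurable [set w | b n w]) ->
  (forall n, measurable_fun setT (F n)) ->
  measurable_fun setT (fun w => \sum_(n < np w | b n w) F n w).
Proof.
move=> mnp mb mF.
apply: (@measurable_fun_random_index _ _ (fun m w => \sum_(n < m | b n w) F n w)) => // m.
under eq_fun do rewrite big_mkcond.
apply: measurable_sum => n.
apply: measurable_fun_ifT => //.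
by apply: (measurable_fun_bool true); rewrite setTI; exact: mb.
Qed.

End random_sums.

(** * The visible cap and its slices *)

Section sat_geometry.
Context (R : realType) (p : params R).
Hypothesis pv : valid_params p.

Let Ru0 := R_us_gt0 pv.
Let RsRu := R_s_gt pv.
Let Rs0 : 0 < R_s p := lt_trans Ru0 RsRu.
Let RsRu2 : 0 <= R_s p ^+ 2 - R_us p ^+ 2.
Proof. by rewrite subr_ge0 lerXn2r ?nnegrE ?(ltW Rs0) ?(ltW Ru0) ?(ltW RsRu). Qed.

(** Law of cosines. On a sphere the squared distance to the user is affine and decreasing in the
    height, so caps, slices and ties all reduce to the third coordinate. *)
Lemma dist_u1_sq (rho : R) x : sphere3 rho x ->
  dist3 x (u1 p) ^+ 2 = rho ^+ 2 + R_us p ^+ 2 - 2 * R_us p * x.2.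
Proof.
move=> <-; rewrite !dist3_sq /= !subr0; ring.
Qed.

Lemma sin_theta_itv : 0 <= sin (theta p) <= 1.
Proof.
have /andP[t0 t1] := theta_itv pv.
rewrite sin_le1 andbT sin_ge0_pi// t0 /= (le_trans (ltW t1))//.
by rewrite ler_pdivrMr// ler_peMr ?pi_ge0// ler1n.
Qed.

(** The quadratic equation of which [Rmax_s] is a root, free of the square root. *)
Lemma Rmax_eq :
  Rmax_s p ^+ 2 + 2 * R_us p * sin (theta p) * Rmax_s p =
  R_s p ^+ 2 - R_us p ^+ 2.
Proof.
rewrite /Rmax_s /Rmax.
have D0 : 0 <= R_s p ^+ 2 - R_us p ^+ 2 + R_us p ^+ 2 * sin (theta p) ^+ 2.
  by apply: addr_ge0 => //; rewrite mulr_ge0 ?sqr_ge0.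
have := sqr_sqrtr D0; set q := Num.sqrt _ => qD.
transitivity (q ^+ 2 - R_us p ^+ 2 * sin (theta p) ^+ 2); first by ring.
by rewrite qD; ring.
Qed.

Lemma Rmin_gt0 : 0 < Rmin_s p.
Proof. by rewrite /Rmin_s /Rmin subr_gt0. Qed.

Lemma Rmin_le_Rmax : Rmin_s p <= Rmax_s p.
Proof.
have /andP[s0 s1] := sin_theta_itv.
rewrite /Rmax_s /Rmax lerBrDr -[leLHS]ger0_norm; last first.
  by rewrite addr_ge0 ?mulr_ge0 ?(ltW Rmin_gt0)// ltW.
rewrite -sqrtr_sqr ler_sqrt; last first.
  by apply: addr_ge0 => //; rewrite mulr_ge0 ?sqr_ge0.
rewrite /Rmin_s /Rmin.
(* This product is exactly the difference of the two quantities compared after squaring. *)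
have : 0 <= (R_s p - R_us p) * (2 * R_us p * (1 - sin (theta p))).
  by rewrite !mulr_ge0 ?subr_ge0 ?(ltW RsRu)// ltW.
by nra.
Qed.

Lemma Rmax_sq_le : Rmax_s p ^+ 2 <= R_s p ^+ 2 - R_us p ^+ 2.
Proof.
have /andP[s0 s1] := sin_theta_itv.
rewrite -Rmax_eq lerDl !mulr_ge0// ?ltW//.
by rewrite (lt_le_trans Rmin_gt0)// Rmin_le_Rmax.
Qed.

(** With d^2 <= R_s^2 - R_us^2, the law of cosines even puts the satellite at height at least
    R_us. *)
Lemma visible_sat_z x : visible_region p Sat x -> 0 < x.2 <= R_s p.
Proof.
move=> [sx dx]; have h := dist_u1_sq sx.
have Mge0 : 0 <= Rmax_s p by rewrite (le_trans (ltW Rmin_gt0))// Rmin_le_Rmax.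
have h2 : dist3 x (u1 p) ^+ 2 <= Rmax_s p ^+ 2.
  by rewrite lerXn2r ?nnegrE ?dist3_ge0.
have M2 := Rmax_sq_le.
apply/andP; split.
  rewrite -(pmulr_rgt0 _ Ru0).
  have := exprn_gt0 2 Ru0; move: h2 M2; rewrite h => h2 M2 R2.
  by lra.
have : dist3 x 0 ^+ 2 = R_s p ^+ 2 by rewrite sx.
rewrite dist3_sq /= !subr0 => h3.
have : x.2 ^+ 2 <= R_s p ^+ 2.
  by rewrite -h3 lerDr addr_ge0// sqr_ge0.
rewrite -[x.2 ^+ 2]real_normK ?num_real// ler_sqr ?nnegrE ?(ltW Rs0)//.
exact: (le_trans (ler_norm _)).
Qed.

Lemma visible_sat_dist x : visible_region p Sat x ->
  Rmin_s p <= dist3 x (u1 p) <= Rmax_s p.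
Proof.
move=> vx; have [sx dx] := vx; rewrite dx andbT.
have /andP[_ zR] := visible_sat_z vx.
have h := dist_u1_sq sx.
rewrite -(ler_sqr (x := Rmin_s p)) ?nnegrE ?dist3_ge0 ?(ltW Rmin_gt0)//.
rewrite h /Rmin_s /Rmin.
have : R_us p * x.2 <= R_us p * R_s p by rewrite ler_pM2l.
by nra.
Qed.

(** The area of a cap is 2 pi R_s times its height, and the law of cosines gives the height (Rmax^2
    - Rmin^2) / (2 R_us). This is where the factor R_s / R_us of [lam_tilde] comes from. *)
Lemma sphere_area_visible :
  ((lam_s p)%:E * sphere_area (R_s p) (visible_region p Sat) =
   (lam_tilde_s p * pi * (Rmax_s p ^+ 2 - Rmin_s p ^+ 2))%:E)%E.
Proof.
have M2 := Rmax_sq_le.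
have Mm : Rmin_s p ^+ 2 <= Rmax_s p ^+ 2.
  rewrite lerXn2r ?nnegrE ?Rmin_le_Rmax ?(ltW Rmin_gt0)//.
  by rewrite ltW// (lt_le_trans Rmin_gt0)// Rmin_le_Rmax.
(* The cosine of the polar angle at which the distance to the user equals [Rmax_s p]. *)
pose c0 := (R_s p ^+ 2 + R_us p ^+ 2 - Rmax_s p ^+ 2) / (2 * R_us p * R_s p).
have d0 : 0 < 2 * R_us p * R_s p by rewrite !mulr_gt0.
have c01 : -1 <= c0 <= 1.
  rewrite /c0 ler_pdivlMr// ler_pdivrMr// mul1r; apply/andP; split; first by nra.
  by move: Mm; rewrite /Rmin_s /Rmin; nra.
rewrite (@sphere_area_cap _ _ (acos c0)).
- rewrite acosK ?in_itv// -EFinM; congr EFin.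
  rewrite /c0 /lam_tilde_s /lam_tilde /Rmin_s /Rmin; field.
  by rewrite !gt_eqF.
- by rewrite acos_ge0// acos_lepi.
- move=> a api; have sa := sphere_param_in a (ltW Rs0).
  have h := dist_u1_sq sa.
  have -> : (a.1 <= acos c0) = (c0 <= cos a.1).
    rewrite -[in RHS](@acosK _ c0) ?in_itv// leNgt [RHS]leNgt ltr_cos//.
    by rewrite in_itv /= acos_ge0// acos_lepi.
  have -> : (c0 <= cos a.1) = (dist3 (sphere_param (R_s p) a) (u1 p) <= Rmax_s p).
    rewrite -[RHS]ler_sqr ?nnegrE ?dist3_ge0//; last first.
      by rewrite (le_trans (ltW Rmin_gt0))// Rmin_le_Rmax.
    rewrite h /= /c0 ler_pdivrMr//; apply/idP/idP => hh; nra.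
  by split => [[]|].
Qed.

(* Slice between two consecutive of the polar angles [pi * i / k.+1]. The south
   pole lies in no slice; visible satellites are in the upper half-space. *)
Definition slice (k i : nat) : set (R * R * R) := sphere3 (R_s p) `&`
  [set x | R_s p * cos (pi * i.+1%:R / k.+1%:R) < x.2 <=
           R_s p * cos (pi * i%:R / k.+1%:R)].

Lemma measurable_slice k i : measurable (slice k i).
Proof.
apply: measurableI; first exact: measurable_sphere3.
rewrite (_ : [set x | _] = snd @^-1` `](R_s p * cos (pi * i.+1%:R / k.+1%:R)),
  (R_s p * cos (pi * i%:R / k.+1%:R))]).
  by rewrite -[X in measurable X]setTI; exact: measurable_snd.
by apply/seteqP; split => x /=; rewrite in_itv.
Qed.

Lemma slice_area k i : (i <= k)%N ->
  (sphere_area (R_s p) (slice k i) <= (2 * pi ^+ 2 * R_s p ^+ 2 / k.+1%:R)%:E)%E.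
Proof.
move=> ik; have k0 : 0 < k.+1%:R :> R by rewrite ltr0n.
have pig0 := pi_gt0 R.
have le1 (n : nat) : (n <= k.+1)%N -> 0 <= (pi : R) * n%:R / k.+1%:R <= pi.
  move=> nk; rewrite divr_ge0 ?mulr_ge0 ?ler0n ?(ltW pig0)//=.
  by rewrite ler_pdivrMr// ler_pM2l// ler_nat.
have /andP[h0 h1] := le1 _ (leqW ik).
have /andP[h2 h3] := le1 i.+1 ik.
rewrite (_ : 2 * pi ^+ 2 * _ / _ = 2 * pi * R_s p ^+ 2 *
    (pi * i.+1%:R / k.+1%:R - pi * i%:R / k.+1%:R)); last first.
  rewrite -(natr1 i); field; by rewrite addrC natr1 gt_eqF.
apply: sphere_area_slice => //.
  by rewrite ler_pM2r ?invr_gt0// ler_pM2l// ler_nat.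
move=> a api; have sa := sphere_param_in a (ltW Rs0).
rewrite -[X in X && _]negbK -ltNge -ltr_cos//; last by rewrite in_itv /= h0.
rewrite -leNgt -[X in _ && X]ltr_cos//; last by rewrite in_itv /= h2.
by rewrite /slice /= !ltr_pM2l// !ler_pM2l// andbC; split => [[]|].
Qed.

Lemma slice_cover k x : visible_region p Sat x ->
  exists2 i, (i <= k)%N & slice k i x.
Proof.
move=> vx; have /andP[x0 xR] := visible_sat_z vx; have [sx _] := vx.
(* The least i with [Q i] is the slice: minimality gives its upper boundary, and for i = 0 that
   boundary is the bound R_s on the height. *)
pose Q i := R_s p * cos (pi * i.+1%:R / k.+1%:R) < x.2.
have exQ : exists i, Q i.
  exists k; rewrite /Q mulfK ?pnatr_eq0// cospi mulrN1.
  by rewrite (lt_trans _ x0)// oppr_lt0.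
have Qk : Q k.
  by rewrite /Q mulfK ?pnatr_eq0// cospi mulrN1 (lt_trans _ x0)// oppr_lt0.
case: (ex_minnP exQ) => i Qi mini; exists i; first exact: mini.
split => //=; apply/andP; split; first exact: Qi.
case: i Qi mini => [_ _|i _ mini]; first by rewrite mulr0 mul0r cos0 mulr1.
by rewrite leNgt; apply/negP => Qi; have := mini i Qi; rewrite ltnn.
Qed.

Lemma visible_sat_dist_z x y : visible_region p Sat x -> visible_region p Sat y ->
  dist3 x (u1 p) = dist3 y (u1 p) -> x.2 = y.2.
Proof.
move=> [sx _] [sy _] dxy; have := dist_u1_sq sx; rewrite dxy (dist_u1_sq sy).
by move=> /addrI/oppr_inj/mulfI ->//; rewrite mulf_neq0 ?gt_eqF.
Qed.

Lemma measurable_cap (Ro r : R) : measurable (cap p Ro r).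
Proof.
by apply: measurableI; [exact: measurable_sphere3|exact: measurable_closed_ball3].
Qed.

Lemma measurable_visible_region l : measurable (visible_region p l).
Proof.
case: l; [exact: measurable_cap|exact: measurable_cap|].
by apply: measurable_disc; [exact: e1_unit|exact: e2_unit|exact: e12_orth].
Qed.

End sat_geometry.

(** * Derivatives of the Laplace transform *)

Section laplace.
Context (R : realType) (nu : {measure set (measurableTypeR R) -> \bar R}).
Hypothesis nu1 : nu setT = 1%E.
Hypothesis nu_neg : nu `]-oo, 0%R[%classic = 0%E.

Let D : set (measurableTypeR R) := `[0, +oo[%classic.

Let mD : measurable D. Proof. exact: measurable_itv. Qed.

Lemma bounded_on_integrable (g : measurableTypeR R -> R) (C : R) :
  measurable_fun setT g -> (forall y, 0 <= y -> `|g y| <= C) ->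
  nu.-integrable D (EFin \o g).
Proof.
move=> mg gC; apply: measurable_bounded_integrable => //.
- have DT : (nu D <= nu setT)%E by apply: le_measure; rewrite ?inE.
  by rewrite (le_lt_trans DT)// nu1 ltry.
- exact: measurable_funTS.
- exists C; split; first exact: num_real.
  move=> x Cx y; rewrite /D /= in_itv /= andbT => y0.
  by apply: (le_trans (gC _ y0)); exact: ltW.
Qed.

Let g (v : nat) (s : R) (y : measurableTypeR R) : R :=
  (- y) ^+ v * expR (- (s * y)).

Let measurable_g v s : measurable_fun setT (g v s).
Proof.
apply: measurable_funM.
  by apply: measurable_funX; exact: measurable_funN.
apply: measurableT_comp; first exact: measurable_expR.
by apply: measurable_funN; apply: measurable_funM.
Qed.

(** This is e^(s y) >= (s y)^v / v!. The bound does not depend on y, so it is integrable for a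
    probability measure. *)
Lemma exprn_expRN_le (v : nat) (s y : R) : 0 < s -> 0 <= y ->
  y ^+ v * expR (- (s * y)) <= v`!%:R / s ^+ v.
Proof.
move=> s0 y0; have sy0 : 0 <= s * y by rewrite mulr_ge0// ltW.
have f0 : 0 < v`!%:R :> R by rewrite ltr0n fact_gt0.
rewrite expRN ler_pdivrMr ?expR_gt0// mulrAC ler_pdivlMr ?exprn_gt0//.
rewrite mulrC -exprMn [leRHS]mulrC -ler_pdivrMr//.
case: v f0 => [|v] f0.
  by rewrite expr0 fact0 divr1 -expR0 ler_expR.
by apply: le_trans (expR_ge1Dxn v sy0); rewrite lerDr.
Qed.

Let g_bound v u s y : 0 < u -> u <= s -> 0 <= y ->
  `|g v s y| <= v`!%:R / u ^+ v.
Proof.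
move=> u0 us y0; rewrite /g normrM normrX normrN (ger0_norm y0).
rewrite (ger0_norm (expR_ge0 _)); apply: le_trans (exprn_expRN_le v u0 y0).
by rewrite ler_wpM2l ?exprn_ge0// ler_expR lerN2 ler_wpM2r.
Qed.

Lemma integrable_laplace v s : 0 < s -> nu.-integrable D (EFin \o g v s).
Proof.
move=> s0; apply: (@bounded_on_integrable _ (v`!%:R / s ^+ v)) => //.
by move=> y; exact: g_bound.
Qed.

(** The integral moves to the half-line [D] at order zero: e^(- s y) is unbounded for y < 0, which
    [nu] does not charge, while on [D] constants dominate. *)
Lemma derive1n_laplace v s : 0 < s ->
  derive1n v (fun s => \int[nu]_(y in [set: measurableTypeR R]) expR (- (s * y))) s
  = \int[nu]_(y in D) ((- y) ^+ v * expR (- (s * y))).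
Proof.
elim: v s => [|v ih] s s0.
  rewrite derive1n0 /Rintegral; congr fine.
  rewrite (@ge0_negligible_integral _ _ _ nu _ (`]-oo, 0%R[%classic : set (measurableTypeR R)))//.
  - rewrite (_ : _ `\` _ = D).
      by apply: eq_integral => y _; rewrite expr0 mul1r.
    apply/seteqP; split => y; rewrite /D /= !in_itv /= andbT.
      by move=> [_ /negP]; rewrite -leNgt.
    by move=> y0; split => //; apply/negP; rewrite -leNgt.
  - apply/measurable_EFinP.
    apply: measurableT_comp; first exact: measurable_expR.
    by apply: measurable_funN; apply: measurable_funM.
rewrite derive1nS derive1E.
pose F x := \int[nu]_(y in D) (g v x y).
have -> : 'D_1 (derive1n v (fun s => \int[nu]_(y in [set: measurableTypeR R])
    expR (- (s * y)))) s = 'D_1 F s.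
  (* The induction hypothesis holds only for positive arguments, hence an equality of functions near
     s. *)
  apply: near_eq_derive; near=> x; apply: ih.
  by near: x; exact: lt_nbhsr.
rewrite -derive1E.
have dg (x y : R) : is_derive x 1 (g v ^~ y) (g v.+1 x y).
  have h1 : is_derive x 1 (fun x : R => - (x * y)) (- y).
    have h := is_deriveZ (- y) (is_derive_id x (1 : R)).
    rewrite -[X in is_derive _ _ X _](_ : (- y) \*: id = _); last first.
      by apply/funext => t; rewrite /= /GRing.scale /= mulNr mulrC.
    by apply: (is_derive_eq h); rewrite /GRing.scale /= mulr1.
  have h2 := @is_derive1_comp R expR (fun x : R => - (x * y)) x _ _ (is_derive_expR _) h1.
  apply: (is_derive_eq (is_deriveZ ((- y) ^+ v) h2)).
  by rewrite /GRing.scale /= /g exprS; ring.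
have dgE (x y : R) : partial1of2 (g v) x y = g v.+1 x y.
  by rewrite partial1of2E; have [] := dg x y.
(* The neighbourhood ]s/2, s+1[ stays away from 0, so the bound at s/2 dominates all derivatives in
   it. *)
rewrite (@differentiation_under_integral R _ _ nu (g v) D mD s (s / 2) (s + 1) _ _ _
  (fun=> v.+1`!%:R / (s / 2) ^+ v.+1)).
- by apply: eq_Rintegral => y _; rewrite dgE.
- by rewrite /= in_itv /= ltr_pdivrMr// ltrDl ltr01 andbT mulr_natr mulr2n ltrDr.
- move=> x; rewrite /= in_itv /= => /andP[x0 _]; apply: integrable_laplace.
  by apply: lt_trans x0; rewrite divr_gt0.
- by move=> x y _ _; have [] := dg x y.
- by move=> y; rewrite divr_ge0// exprn_ge0// divr_ge0// ltW.
- apply: (@bounded_on_integrable _ `|v.+1`!%:R / (s / 2) ^+ v.+1|) => //.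
- move=> x y; rewrite /D /= !in_itv /= andbT => /andP[x0 _] y0.
  by rewrite dgE; apply: g_bound => //; [rewrite divr_gt0|exact: ltW].
Unshelve. all: by end_near. Qed.

End laplace.
(** Integrability and value are proved together because additivity of the real-valued integral asks
    for integrability of the remaining sum. *)
Lemma Rintegral_sum d (T : measurableType d) (R : realType)
    (mu : {measure set T -> \bar R}) (D : set T) (I : Type) (s : seq I)
    (F : I -> T -> R) :
  measurable D -> (forall i, mu.-integrable D (EFin \o F i)) ->
  mu.-integrable D (EFin \o (fun x => \sum_(i <- s) F i x)) /\
  \int[mu]_(x in D) (\sum_(i <- s) F i x) =
  \sum_(i <- s) \int[mu]_(x in D) F i x.
Proof.
move=> mD iF; elim: s => [|i s [ih1 ih2]].
  rewrite (_ : (fun x => \sum_(i <- [::]) F i x) = cst 0); last first.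
    by apply/funext => x; rewrite big_nil.
  split; first exact: integrable0.
  by rewrite big_nil /Rintegral integral0.
rewrite (_ : (fun x => \sum_(j <- i :: s) F j x) =
    (fun x => F i x + \sum_(j <- s) F j x)); last first.
  by apply/funext => x; rewrite big_cons.
split.
  pose g x := \sum_(j <- s) F j x.
  rewrite (_ : EFin \o _ = ((EFin \o F i) \+ (EFin \o g))%E)//.
  exact: integrableD.
by rewrite big_cons RintegralD// ih2.
Qed.

Section laplace_ccdf.
Context (R : realType) (p : params R).
Hypothesis pv : valid_params p.
Variable nu : {measure set (measurableTypeR R) -> \bar R}.
Hypothesis nu1 : nu setT = 1%E.
Hypothesis nu_neg : nu `]-oo, 0%R[%classic = 0%E.

Let D : set (measurableTypeR R) := `[0, +oo[%classic.
Let a := beta p - cc p.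
Let L s := \int[nu]_(y in [set: measurableTypeR R]) expR (- (s * y)).

Lemma integral_sr_ccdf (t : R) : 0 < t ->
  (\int[nu]_(y in D) (1 - sr_cdf p (t * y))%:E =
   (1 - \sum_(z < m_s p) zeta p z * Gamma z.+1%:R / a ^+ z.+1 *
     (1 - \sum_(v < z.+1) (a * t) ^+ v / v`!%:R * (-1) ^+ v *
       derive1n v L (a * t)))%:E)%E.
Proof.
move=> t0; have a0 : 0 < a := beta_cc_gt0 pv.
have mD : measurable D by exact: measurable_itv.
set s := a * t; have s0 : 0 < s by rewrite mulr_gt0.
pose G (v : nat) (y : measurableTypeR R) : R := (- y) ^+ v * expR (- (s * y)).
have iG v : nu.-integrable D (EFin \o G v) by exact: integrable_laplace.
have nuD : nu D = 1%E.
  have -> : D = ~` (`]-oo, 0%R[%classic : set (measurableTypeR R)).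
    by rewrite setCitvl.
  rewrite -setTD measureD//=; last by rewrite [X in (X < _)%E]nu1 ltry.
  by rewrite [X in (X - _)%E]nu1 setTI [X in (_ - X)%E]nu_neg sube0.
have i1 : nu.-integrable D (EFin \o (fun=> 1 : R)).
  by apply: (@bounded_on_integrable _ nu nu1 _ 1) => // y _; rewrite normr1.
have iZ (k : R) (g : measurableTypeR R -> R) : nu.-integrable D (EFin \o g) ->
    nu.-integrable D (EFin \o (fun y => k * g y)).
  move=> ig; rewrite (_ : EFin \o _ = (fun y => k%:E * (EFin \o g) y)%E)//.
  exact: integrableZl.
have iB (g h : measurableTypeR R -> R) : nu.-integrable D (EFin \o g) ->
    nu.-integrable D (EFin \o h) -> nu.-integrable D (EFin \o (fun y => g y - h y)).
  move=> ig ih; rewrite (_ : EFin \o _ = (fun y => (EFin \o g) y - (EFin \o h) y)%E)//.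
  exact: integrableB.
have int1 : \int[nu]_(y in D) (1 : R) = 1.
  by rewrite /Rintegral integral_cst// nuD mule1.
pose coef z := zeta p z * Gamma z.+1%:R / a ^+ z.+1.
pose q z (y : measurableTypeR R) := \sum_(v < z.+1) (s ^+ v / v`!%:R * (-1) ^+ v) * G v y.
have texpE z y : texp z (a * (t * y)) * expR (- (a * (t * y))) = q z y.
  rewrite mulrA -/s /q /texp mulr_suml; apply: eq_bigr => v _.
  rewrite /G exprMn [(- y) ^+ v]exprNn.
  (* y^v is written (-1)^v (- y)^v, since (- y)^v is what differentiating e^(- s y) produces; the
     sign of the final formula arises here. *)
  have : (-1) ^+ v * (-1) ^+ v = 1 :> R by rewrite -expr2 sqrr_sign.
  set e := expR _; move: ((-1) ^+ v) => k kk.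
  transitivity (s ^+ v * y ^+ v / v`!%:R * e * (k * k)); first by rewrite kk mulr1.
  by ring.
have qi z := @Rintegral_sum _ _ _ nu D _ (index_enum 'I_z.+1)
  (fun (v : 'I_z.+1) y => (s ^+ v / v`!%:R * (-1) ^+ v) * G v y) mD
  (fun v => iZ _ _ (iG v)).
have ci := @Rintegral_sum _ _ _ nu D _ (index_enum 'I_(m_s p))
  (fun (z : 'I_(m_s p)) y => coef z * (1 - q z y)) mD
  (fun z => iZ _ _ (iB _ _ i1 (qi z).1)).
have E y : 1 - sr_cdf p (t * y) = 1 - \sum_(z < m_s p) coef z * (1 - q z y).
  by rewrite /sr_cdf; congr (_ - _); apply: eq_bigr => z _; rewrite texpE.
under eq_integral do rewrite E.
have itot := iB _ _ i1 ci.1.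
rewrite -[LHS]fineK; last exact: integrable_fin_num.
rewrite -/(Rintegral _ _ _) RintegralB//; last exact: ci.1.
rewrite int1 ci.2; congr (EFin (_ - _)); apply: eq_bigr => z _.
rewrite RintegralZl//; last by apply: iB => //; exact: (qi z).1.
rewrite RintegralB//; last exact: (qi z).1.
rewrite int1 (qi z).2; congr (_ * (_ - _)); apply: eq_bigr => v _.
by rewrite RintegralZl// derive1n_laplace.
Qed.

End laplace_ccdf.

(** * The network *)

(* These functions of the counts, positions and fadings are evaluated both on the
   network itself and on a copy of it where one fading is erased, which is
   measurable with respect to the remaining sources. *)
Section network_functions.
Context (R : realType) (p : params R) (T : Type).
Variables (np : layer -> T -> nat) (q : layer -> nat -> T -> R * R * R).
Variable h : layer -> nat -> T -> R.

Definition gvisible (l : layer) (n : nat) (w : T) : Prop :=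
  (n < np l w)%N /\ visible_region p l (q l n w).

Definition gdist (l : layer) (n : nat) (w : T) : R := dist3 (q l n w) (u1 p).

Definition gnearest (n : nat) : set T :=
  [set w | gvisible Sat n w /\ forall k, gvisible Sat k w ->
    gdist Sat n w < gdist Sat k w \/
    (gdist Sat n w = gdist Sat k w /\ (n <= k)%N)].

Definition greceived (l : layer) (n : nat) (w : T) : R :=
  power p l * h l n w * gdist l n w `^ (- alpha p l).

Definition ginterference (o : mode) (r : R) (w : T) : R :=
  \sum_(n < np Sat w |
        `[< gvisible Sat n w /\ ~ cap p (R_s p) r (q Sat n w) >])
    gain_side p Sat * greceived Sat n w
  + \sum_(n < np (terrestrial o) w | `[< gvisible (terrestrial o) n w >])
      gain_side p (terrestrial o) * greceived (terrestrial o) n w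
  + sigma2 p.

End network_functions.

Section network_measurability.
Context (R : realType) (p : params R) (d : measure_display) (T : measurableType d).
Hypothesis pv : valid_params p.
Variables (np : layer -> T -> nat) (q : layer -> nat -> T -> R * R * R).
Variable h : layer -> nat -> T -> R.
Hypothesis mnp : forall l, measurable_fun setT (np l).
Hypothesis mq : forall l n, measurable_fun setT (q l n).
Hypothesis mh : forall l n, measurable_fun setT (h l n).

Let gvisible := gvisible p np q.
Let gdist := gdist p q.
Let gnearest := gnearest p np q.
Let greceived := greceived p q h.
Let ginterference := ginterference p np q h.

Lemma measurable_gvisible l n : measurable (gvisible l n).
Proof.
rewrite (_ : gvisible l n = (np l @^-1` [set m | (n < m)%N]) `&`
  (q l n @^-1` visible_region p l)).
  apply: measurableI; rewrite -[X in measurable X]setTI; first exact: mnp.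
  by apply: mq => //; exact: measurable_visible_region.
by apply/seteqP; split.
Qed.

Lemma measurable_gdist l n : measurable_fun setT (gdist l n).
Proof. exact: (measurableT_comp (measurable_dist3 (u1 p)) (mq l n)). Qed.

Lemma measurable_gnearest n : measurable (gnearest n).
Proof.
rewrite (_ : gnearest n = gvisible Sat n `&` \bigcap_k
  (~` gvisible Sat k `|` ([set w | gdist Sat n w < gdist Sat k w] `|`
    ([set w | gdist Sat n w = gdist Sat k w] `&` [set w | (n <= k)%N])))).
  apply: measurableI; first exact: measurable_gvisible.
  apply: bigcapT_measurable => k; apply: measurableU.
    by apply: measurableC; exact: measurable_gvisible.
  have mB := measurable_funB (measurable_gdist Sat n) (measurable_gdist Sat k).
  apply: measurableU.
    rewrite (_ : [set w | _] = (gdist Sat n \- gdist Sat k) @^-1` `]-oo, 0[).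
      by rewrite -[X in measurable X]setTI; exact: mB.
    by apply/seteqP; split => w /=; rewrite in_itv /= subr_lt0.
  apply: measurableI.
    rewrite (_ : [set w | _] = (gdist Sat n \- gdist Sat k) @^-1` [set 0]).
      by rewrite -[X in measurable X]setTI; exact: mB.
    apply/seteqP; split => w /=; first by move=> ->; rewrite subrr.
    by move/eqP; rewrite subr_eq0 => /eqP.
  case: (n <= k)%N; last first.
    by rewrite (_ : [set w | _] = set0)//; apply/seteqP; split.
  by rewrite (_ : [set w | _] = setT)//; apply/seteqP; split.
apply/seteqP; split => w /=.
  move=> [vn hn]; split => // k _ /=.
  by have [/hn|] := pselect (gvisible Sat k w); [right|left].
by move=> [vn hn]; split => // k vk; have [|] := hn k I.
Qed.

Lemma measurable_greceived l n : measurable_fun setT (greceived l n).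
Proof.
apply: measurable_funM.
  by apply: measurable_funM => //; exact: mh.
exact: (measurableT_comp (measurable_powR _) (measurable_gdist l n)).
Qed.

Lemma measurable_ginterference o (r : T -> R) : measurable_fun setT r ->
  measurable_fun setT (fun w => ginterference o (r w) w).
Proof.
move=> mr; apply: measurable_funD => //; apply: measurable_funD.
  apply: (measurable_random_sum (b := fun n w =>
    `[< gvisible Sat n w /\ ~ cap p (R_s p) (r w) (q Sat n w) >])
    (F := fun n w => gain_side p Sat * greceived Sat n w)) => //.
    move=> n; rewrite (_ : [set w | _] = gvisible Sat n `&`
      ~` ((q Sat n @^-1` sphere3 (R_s p)) `&` ((fun w => gdist Sat n w - r w) @^-1` `]-oo, 0]))).
      apply: measurableI; first exact: measurable_gvisible.
      apply: measurableC; apply: measurableI; rewrite -[X in measurable X]setTI.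
        by apply: mq => //; exact: measurable_sphere3.
      by apply: measurable_funB => //; exact: measurable_gdist.
    apply/seteqP; split => w /=.
      move=> /asboolP[vn nc]; split => // -[sn]; rewrite in_itv /= subr_le0 => dn.
      by apply: nc; split.
    move=> [vn nc]; apply/asboolP; split => // -[sn dn]; apply: nc; split => //.
    by rewrite in_itv /= subr_le0.
  by move=> n; apply: measurable_funM => //; exact: measurable_greceived.
apply: (measurable_random_sum (b := fun n w =>
    `[< gvisible (terrestrial o) n w >])
    (F := fun n w => gain_side p (terrestrial o) * greceived (terrestrial o) n w)) => //.
  move=> n; rewrite (_ : [set w | _] = gvisible (terrestrial o) n).
    exact: measurable_gvisible.
  by apply/seteqP; split => w /= /asboolP.
by move=> n; apply: measurable_funM => //; exact: measurable_greceived.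
Qed.

End network_measurability.

(** * The serving satellite, visibility and ties *)

Section network_facts.
Context (R : realType) (d : measure_display) (T : measurableType d).
Context (P : probability T R) (p : params R) (N : network P).
Hypothesis pv : valid_params p.
Hypothesis Nm : network_model p N.

Let np (l : layer) : T -> nat := npt (points N l).
Let q (l : layer) (n : nat) : T -> R * R * R := pt (points N l) n.
Let h (l : layer) (n : nat) : T -> R := fading N l n.
Let E := some_visible p N.

Lemma measurable_pt l n : measurable_fun setT (q l n).
Proof. exact: measurable_funP. Qed.

Lemma measurable_fading l n : measurable_fun setT (h l n).
Proof. exact: measurable_funP. Qed.

Lemma pp_countE (Phi : point_process P) (B : set (R * R * R)) w :
  pp_count Phi B w = (\sum_(n < npt Phi w | `[< B (pt Phi n w) >]) 1)%N.
Proof.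
by rewrite /pp_count [RHS]big_mkcond; apply: eq_bigr => n _; case: asboolP.
Qed.

Lemma pp_count_ge1 (Phi : point_process P) (B : set (R * R * R)) w :
  (1 <= pp_count Phi B w)%N <-> exists2 n, (n < npt Phi w)%N & B (pt Phi n w).
Proof.
rewrite pp_countE sum1_card; split.
  by move/card_gt0P => [n /asboolP Bn]; exists n.
move=> [n nn Bn]; apply/card_gt0P; exists (Ordinal nn).
by rewrite unfold_in; apply/asboolP.
Qed.

Lemma pp_count_ge2 (Phi : point_process P) (B : set (R * R * R)) w i j :
  (i < npt Phi w)%N -> (j < npt Phi w)%N -> i != j ->
  B (pt Phi i w) -> B (pt Phi j w) -> (2 <= pp_count Phi B w)%N.
Proof.
move=> ii jj ij Bi Bj; rewrite pp_countE sum1_card.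
rewrite (_ : 2%N = #|pred2 (Ordinal ii) (Ordinal jj)|).
  apply: subset_leq_card; apply/fintype.subsetP => x.
  by rewrite !inE => /orP[] /eqP ->.
by rewrite card2 -val_eqE /= ij.
Qed.

Lemma measurable_pp_count (Phi : point_process P) (B : set (R * R * R)) k :
  measurable B -> measurable [set w | (k <= pp_count Phi B w)%N].
Proof.
move=> mB; pose g w : R := \sum_(n < npt Phi w | `[< B (pt Phi n w) >]) 1.
have mg : measurable_fun setT g.
  apply: (measurable_random_sum (b := fun n w => `[< B (pt Phi n w) >])
    (F := fun _ _ => 1)) => //.
  move=> n; rewrite (_ : [set w | _] = pt Phi n @^-1` B).
    by rewrite -[X in measurable X]setTI; exact: measurable_funP.
  by apply/seteqP; split => w /= /asboolP.
rewrite (_ : [set w | _] = g @^-1` `[k%:R, +oo[).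
  by rewrite -[X in measurable X]setTI; exact: mg.
apply/seteqP; split => w /=; rewrite in_itv /= andbT /g pp_countE;
  by rewrite -[X in _ <= X](natr_sum _ _ _ (fun=> 1%N)) ler_nat.
Qed.

Lemma some_visibleP w : E w <-> exists n, gvisible p np q Sat n w.
Proof.
rewrite /E /some_visible /= pp_count_ge1; split.
  by move=> [n nn vn]; exists n.
by move=> [n [nn vn]]; exists n.
Qed.

Lemma gnearest_uniq n k w : gnearest p np q n w -> gnearest p np q k w -> n = k.
Proof.
move=> [vn hn] [vk hk].
have [h1|[e1 h1]] := hn _ vk; have [h2|[e2 h2]] := hk _ vn.
- by have := lt_trans h1 h2; rewrite ltxx.
- by move: h1; rewrite e2 ltxx.
- by move: h2; rewrite e1 ltxx.
- by apply/eqP; rewrite eqn_leq h1 h2.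
Qed.

(** Two successive minima: the distance over the finitely many visible points, then the label among
    those at that distance. *)
Lemma gnearest_exists w : E w -> exists n, gnearest p np q n w.
Proof.
move/some_visibleP => [n0 [n0n v0]].
pose pv' (i : 'I_(np Sat w)) := `[< visible_region p Sat (q Sat i w) >].
have p0 : pv' (Ordinal n0n) by apply/asboolP.
case: (Order.TotalTheory.arg_minP
  (fun i : 'I_(np Sat w) => gdist p q Sat i w) p0) => i /asboolP vi mini.
pose Q n := `[< gvisible p np q Sat n w /\ gdist p q Sat n w = gdist p q Sat i w >].
have exQ : exists n, Q n by exists i; apply/asboolP.
case: (ex_minnP exQ) => n /asboolP[vn en] minn.
exists n; split => // k vk.
have [kn vk'] := vk.
have := mini (Ordinal kn) (introT (asboolP _) vk').
rewrite le_eqVlt => /predU1P[ek|lt]; last by left; rewrite en.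
right; split; first by rewrite en.
by apply: minn; apply/asboolP.
Qed.

Lemma servingP w : E w -> gnearest p np q (serving p N w) w.
Proof.
move=> Ew; rewrite /serving; case: xgetP => [n _ hn|h0]; first exact: hn.
by have [n hn] := gnearest_exists Ew; have := h0 n; case.
Qed.

Lemma gnearest_some_visible n w : gnearest p np q n w -> E w.
Proof. by move=> [vn _]; apply/some_visibleP; exists n. Qed.

Lemma gnearest_serving n w : gnearest p np q n w -> serving p N w = n.
Proof. by move=> hn; apply: gnearest_uniq (servingP (gnearest_some_visible hn)) hn. Qed.

Lemma measurable_gnearestN n : measurable (gnearest p np q n).
Proof.
by apply: measurable_gnearest.
Qed.

Lemma some_visible_bigcup : E = \bigcup_n gnearest p np q n.
Proof.
apply/seteqP; split => w; first by move=> /gnearest_exists[n hn]; exists n.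
by move=> [n _ hn]; exact: gnearest_some_visible hn.
Qed.

Lemma measurable_some_visible : measurable E.
Proof.
by rewrite some_visible_bigcup; apply: bigcupT_measurable => n; exact: measurable_gnearestN.
Qed.

Lemma measurable_serving : measurable_fun setT (serving p N).
Proof.
move=> _ B mB; rewrite setTI.
rewrite (_ : _ @^-1` _ = \bigcup_(n in B) gnearest p np q n `|`
  (~` E `&` [set w | B 0%N])).
  apply: measurableU.
    by apply: bigcup_measurable => n _; exact: measurable_gnearestN.
  apply: measurableI; first by apply: measurableC; exact: measurable_some_visible.
  have [B0|B0] := pselect (B 0%N).
    by rewrite (_ : [set w | _] = setT)//; apply/seteqP; split.
  by rewrite (_ : [set w | _] = set0)//; apply/seteqP; split.
(* With no visible satellite [xget] returns its default 0, whence the second piece of the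
   preimage. *)
have s0 w : ~ E w -> serving p N w = 0%N.
  move=> nE; rewrite /serving; case: xgetP => // n _ hn.
  by exfalso; apply: nE; exact: (gnearest_some_visible (n := n)).
apply/seteqP; split => w /=.
  move=> Bs; have [Ew|nEw] := pselect (E w); last by right; rewrite -(s0 w).
  by left; exists (serving p N w) => //; exact: servingP.
by move=> [[n Bn /gnearest_serving ->//]|[/s0 ->]].
Qed.

Lemma measurable_serving_dist : measurable_fun setT (serving_dist p N).
Proof.
apply: (@measurable_fun_random_index _ _ _ _ (fun n => gdist p q Sat n)).
  exact: measurable_serving.
by move=> n; apply: measurable_gdist; exact: measurable_pt.
Qed.

Lemma measurable_serving_fading :
  measurable_fun setT (fun w => h Sat (serving p N w) w).
Proof.
apply: (@measurable_fun_random_index _ _ _ _ (h Sat)).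
  exact: measurable_serving.
exact: measurable_fading.
Qed.

Lemma measurable_interference_noise o :
  measurable_fun setT (fun w => interference_noise p N o (serving_dist p N w) w).
Proof.
apply: (@measurable_ginterference _ _ _ _ pv np q h) => //.
exact: measurable_serving_dist.
Qed.

Lemma probability_some_visible :
  P E = (1 - expR (- (lam_tilde_s p * pi * (Rmax_s p ^+ 2 - Rmin_s p ^+ 2))))%:E.
Proof.
have mV := measurable_visible_region pv Sat.
have EC : E = ~` (pp_count (points N Sat) (visible_region p Sat) @^-1` [set 0%N]).
  apply/seteqP; split => w /=; rewrite /E /some_visible /= lt0n.
    by move/eqP.
  by move=> ?; apply/eqP.
have m0 : measurable (pp_count (points N Sat) (visible_region p Sat) @^-1` [set 0%N]).
  by rewrite -[X in measurable X]setCK -EC; apply: measurableC; exact: measurable_some_visible.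
rewrite EC probability_setC//.
have [hp _] := points_poisson Nm Sat.
rewrite (hp _ mV [set 0%N]) /= sphere_area_visible//= poisson_prob_0 ?EFinB//.
rewrite mulr_ge0 ?subr_ge0 ?lerXn2r ?nnegrE ?Rmin_le_Rmax ?(ltW (Rmin_gt0 pv))//.
  rewrite mulr_ge0 ?pi_ge0// /lam_tilde_s /lam_tilde.
  rewrite mulr_ge0 ?divr_ge0 ?(ltW (lam_s_gt0 pv)) ?(ltW (R_us_gt0 pv))//.
  by rewrite ltW// (lt_trans (R_us_gt0 pv)) ?(R_s_gt pv).
by rewrite (le_trans (ltW (Rmin_gt0 pv)))// Rmin_le_Rmax.
Qed.

Definition sat_tie : set T := [set w | exists i j, [/\ i != j,
  gvisible p np q Sat i w, gvisible p np q Sat j w &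
  gdist p q Sat i w = gdist p q Sat j w]].

(* Tied satellites lie in a common slice, and the probability that one of k
   slices of measure O(1/k) holds two points is O(1/k). *)
Lemma sat_tie_negligible : P.-negligible sat_tie.
Proof.
pose S k i := [set w | (2 <= pp_count (points N Sat) (slice p k i) w)%N].
have mS k i : measurable (S k i).
  by apply: measurable_pp_count; exact: measurable_slice.
pose M := \bigcap_k \big[setU/set0]_(i < k.+1) S k i.
have mM : measurable M.
  by apply: bigcapT_measurable => k; apply: bigsetU_measurable.
exists M; split => //; last first.
  move=> w [i [j [ij vi vj dij]]] k _.
  have [vi1 vi2] := vi; have [vj1 vj2] := vj.
  have zz := visible_sat_dist_z pv vi2 vj2 dij.
  have [s sk si] := slice_cover pv k vi2.
  rewrite -bigcup_mkord; exists s; first by rewrite /= ltnS.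
  apply: (@pp_count_ge2 _ _ _ i j) => //.
  by split; [case: vj2|move: si => [_ /=]; rewrite zz].
(* C / (k + 1) bounds the mean number of satellites in a slice, so the k + 1 slices together
   contribute at most C^2 / (k + 1). *)
pose C := lam_s p * (2 * pi ^+ 2 * R_s p ^+ 2).
have lam0 := lam_s_gt0 pv.
have C0 : 0 <= C.
  rewrite /C mulr_ge0 ?(ltW lam0)// mulr_ge0 ?sqr_ge0// mulr_ge0//.
  exact: sqr_ge0.
have bound k : (P M <= (C ^+ 2 / k.+1%:R)%:E)%E.
  apply: (@le_trans _ _ (P (\big[setU/set0]_(i < k.+1) S k i))).
    by apply: le_measure; rewrite ?inE//; [apply: bigsetU_measurable|exact: bigcap_inf].
  apply: (@le_trans _ _ (\sum_(i < k.+1) P (S k i))%E).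
    exact: Boole_inequality.
  apply: (@le_trans _ _ (\sum_(i < k.+1) ((C / k.+1%:R) ^+ 2)%:E)%E).
    apply: lee_sum => i _.
    have [hp _] := points_poisson Nm Sat.
    have -> : P (S k i) =
      P (pp_count (points N Sat) (slice p k i) @^-1` [set n | (2 <= n)%N]) by [].
    rewrite hp; last exact: measurable_slice.
    apply: le_trans (poisson_prob_ge2 _) _; rewrite lee_fin.
    have ia : (0 <= intensity p Sat (slice p k i) <= (C / k.+1%:R)%:E)%E.
      rewrite /intensity; apply/andP; split.
        rewrite mule_ge0 ?lee_fin ?(ltW lam0)//; apply: integral_ge0 => a [[a1 _] _].
        move: a1; rewrite /= in_itv /= => /andP[a0 api].
        by rewrite lee_fin mulr_ge0 ?sqr_ge0// sin_ge0_pi// a0.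
      rewrite /C -mulrA EFinM lee_pmul2l ?lte_fin//.
      by apply: slice_area => //; rewrite -ltnS.
    move/andP: ia => [i0 iC].
    have fi : intensity p Sat (slice p k i) \is a fin_num.
      by rewrite ge0_fin_numE// (le_lt_trans iC)// ltry.
    rewrite lerXn2r ?nnegrE ?fine_ge0// ?divr_ge0//.
    by rewrite -lee_fin fineK.
  rewrite sumEFin sumr_const card_ord lee_fin -mulr_natr.
  rewrite le_eqVlt; apply/orP; left; apply/eqP; field.
  by rewrite addrC natr1 pnatr_eq0.
apply/eqP; rewrite eq_le measure_ge0 andbT.
apply/lee_addgt0Pr => e e0; rewrite add0e.
pose k := Num.bound (C ^+ 2 / e).
apply: le_trans (bound k) _; rewrite lee_fin ler_pdivrMr ?ltr0n//.
rewrite mulrC -ler_pdivrMr//.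
have := archi_boundP (divr_ge0 (sqr_ge0 C) (ltW e0)); rewrite -/k => h1.
by rewrite ltW// (lt_le_trans h1)// ler_nat.
Qed.

Lemma fading_le0_negligible l n : P [set w | h l n w <= 0] = 0%E.
Proof. exact: fading_le0_null (fading_law Nm l n). Qed.

End network_facts.

(** * Integrating out the fading of the serving satellite *)

(** Encoding that makes [layer] a choice type, so that [layer * option nat] can index the sources in
    [independent_rest]. *)
Definition layer_code (l : layer) : 'I_3 :=
  match l with Sat => inord 0 | Bs => inord 1 | Ut => inord 2 end.

Definition layer_decode (i : 'I_3) : layer :=
  match nat_of_ord i with 0 => Sat | 1 => Bs | _ => Ut end%N.

Lemma layer_codeK : cancel layer_code layer_decode.
Proof. by case; rewrite /layer_decode /= inordK. Qed.

HB.instance Definition _ := Choice.copy layer (can_type layer_codeK).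

Section tail_given_sources.
Context (R : realType) (d : measure_display) (T : measurableType d).
Context (P : probability T R) (p : params R) (N : network P).
Hypothesis pv : valid_params p.
Hypothesis Nm : network_model p N.

Let np (l : layer) : T -> nat := npt (points N l).
Let q (l : layer) (n : nat) : T -> R * R * R := pt (points N l) n.
Let h (l : layer) (n : nat) : T -> R := fading N l n.
Let E := some_visible p N.

(** [sr_cdf] has no probabilistic meaning at negative arguments. The value 0 there matches the event
    0 <= x < H and lets a negative threshold encode an excluded outcome. *)
Definition sr_ccdf_pos (x : R) : R := if 0 <= x then 1 - sr_cdf p x else 0.

Lemma measurable_sr_ccdf_pos : measurable_fun setT sr_ccdf_pos.
Proof.
apply: measurable_fun_ifT => //.
  apply: (measurable_fun_bool true); rewrite setTI.
  rewrite (_ : _ @^-1` _ = `[0, +oo[%classic)//.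
  by apply/seteqP; split => x /=; rewrite in_itv /= andbT.
by apply: measurable_funB => //; exact: measurable_sr_cdf.
Qed.

Lemma sr_ccdf_pos_fading n x :
  P [set w | 0 <= x /\ x < h Sat n w] = (sr_ccdf_pos x)%:E.
Proof.
rewrite /sr_ccdf_pos; case: ifPn => x0.
  rewrite -(sr_ccdf pv (fading_law Nm Sat n) x0).
  by congr (P _); apply/seteqP; split => w /=; [case|split].
by rewrite (_ : [set w | _] = set0) ?measure0// -subset0 => w [].
Qed.

(** The sign is read off the probability that the formula computes. *)
Lemma sr_ccdf_pos_ge0 x : 0 <= sr_ccdf_pos x.
Proof. by rewrite -lee_fin -(sr_ccdf_pos_fading 0%N). Qed.

Lemma source_sigma_measurable i : source_sigma N i `<=` measurable.
Proof.
case: i => l [n|] A /=.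
  by move=> [B mB ->]; rewrite -[X in measurable X]setTI; exact: measurable_funP.
move: A; apply: smallest_sub; first exact: sigma_algebra_measurable.
move=> _ [n [B [mB ->]]].
rewrite (_ : [set w | _] = (np l @^-1` [set m | (n < m)%N]) `&` (q l n @^-1` B)).
  apply: measurableI; rewrite -[X in measurable X]setTI; exact: measurable_funP.
by apply/seteqP; split.
Qed.

Lemma source_sigmaI i : setI_closed (source_sigma N i).
Proof.
case: i => l [n|] A B /=.
  move=> [A' mA' ->] [B' mB' ->]; exists (A' `&` B'); first exact: measurableI.
  by rewrite preimage_setI.
exact: (@measurableI _ (g_sigma_algebraType _)).
Qed.

Lemma source_sigmaT i : source_sigma N i setT.
Proof.
case: i => l [n|] /=; first by exists setT => //; rewrite preimage_setT.
exact: (@measurableT _ (g_sigma_algebraType _)).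
Qed.

Section fixed_label.
Variable n : nat.

(** All sources but the fading of satellite n. With the generated sigma-algebra as the structure
    [T'], the measurability lemmas for networks apply as they stand. *)
Let G : set (set T) :=
  \bigcup_(i in [set i | i != ((Sat, Some n) : layer * option nat)])
    source_sigma N i.
Let T' : measurableType _ := g_sigma_algebraType G.

(* Positions are reset beyond the number of points, where they are not
   measurable for [pp_sigma]. *)
Let q' (l : layer) (k : nat) (w : T) : R * R * R :=
  if (k < np l w)%N then q l k w else 0.
Let h' (l : layer) (k : nat) (w : T) : R :=
  if (l, Some k) == ((Sat, Some n) : layer * option nat) then 0 else h l k w.

Let measurable_source i (A : set T) : i != (Sat, Some n) ->
  source_sigma N i A -> measurable (A : set T').
Proof. by move=> iN sA; apply: sub_sigma_algebra; exists i. Qed.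

Let measurable_gen l k (B : set (R * R * R)) : measurable B ->
  measurable ([set w | (k < np l w)%N /\ B (q l k w)] : set T').
Proof.
move=> mB; apply: (@measurable_source (l, None)) => /=; first by rewrite xpair_eqE andbF.
by apply: sub_sigma_algebra; exists k, B.
Qed.

Let mnp l : measurable_fun [set: T'] (np l : T' -> nat).
Proof.
have mge k : measurable ([set w | (k <= np l w)%N] : set T').
  case: k => [|k]; first by rewrite (_ : [set w | _] = setT)//; apply/seteqP; split.
  rewrite (_ : [set w | _] = [set w | (k < np l w)%N /\ setT (q l k w)]).
    exact: measurable_gen.
  by apply/seteqP; split => w //= [].
move=> _ B _; rewrite setTI.
rewrite (_ : _ @^-1` _ = \bigcup_(m in B) ([set w | (m <= np l w)%N] `\`
    [set w | (m.+1 <= np l w)%N])).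
  by apply: bigcup_measurable => m _; apply: measurableD.
apply/seteqP; split => w /=.
  by move=> Bn; exists (np l w) => //; split => //=; rewrite ltnn.
move=> [m Bm [/= h1 /negP]]; rewrite -leqNgt => h2.
by rewrite (_ : np l w = m)//; apply/eqP; rewrite eqn_leq h1 h2.
Qed.

Let mq l k : measurable_fun [set: T'] (q' l k : T' -> _).
Proof.
move=> _ B mB; rewrite setTI.
rewrite (_ : _ @^-1` _ = [set w | (k < np l w)%N /\ B (q l k w)] `|`
   (~` [set w | (k < np l w)%N] `&` [set w | B 0])).
  apply: measurableU; first exact: measurable_gen.
  apply: measurableI.
    apply: measurableC.
    rewrite (_ : [set w | _] = [set w | (k < np l w)%N /\ setT (q l k w)]).
      exact: measurable_gen.
    by apply/seteqP; split => w //= [].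
  have [B0|B0] := pselect (B 0).
    by rewrite (_ : [set w | _] = setT)//; apply/seteqP; split.
  by rewrite (_ : [set w | _] = set0)//; apply/seteqP; split.
apply/seteqP; split => w; rewrite /q' /=.
  by case: ifPn => [kn Bq|/negP kn Bq]; [left|right].
by move=> [[-> ]//|[/negP/negbTE ->]].
Qed.

Let mh l k : measurable_fun [set: T'] (h' l k : T' -> R).
Proof.
rewrite /h'; case: eqP => [_|/eqP ne]; first exact: measurable_cst.
move=> _ B mB; rewrite setTI; apply: (measurable_source ne) => /=.
by exists B.
Qed.

Let gvisible' l k w : gvisible p np q' l k w <-> gvisible p np q l k w.
Proof.
by rewrite /gvisible /q'; split => -[kn]; rewrite kn.
Qed.

Let gdist' l k w : (k < np l w)%N -> gdist p q' l k w = gdist p q l k w.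
Proof. by rewrite /gdist /q' => ->. Qed.

Let gnearest' : gnearest p np q' n = gnearest p np q n.
Proof.
apply/seteqP; split => w [/= vn hn].
  have vn' := (gvisible' _ _ _).1 vn; split => // k vk.
  have := hn k ((gvisible' _ _ _).2 vk).
  by rewrite !gdist' //; [case: vk|case: vn'].
have vn' := (gvisible' _ _ _).2 vn; split => // k vk.
have := hn k ((gvisible' _ _ _).1 vk).
by rewrite !gdist' //; [case: vk|case: vn'].
Qed.

(** The erased fading belongs to satellite n, whose own distance is the radius r, so it is excluded
    from the satellite sum; the terrestrial terms lie in other layers. *)
Let ginterference' o w : gnearest p np q n w ->
  ginterference p np q' h' o (gdist p q' Sat n w) w =
  ginterference p np q h o (gdist p q Sat n w) w.
Proof.
move=> [[nn vn] hn]; rewrite (gdist' nn) /ginterference.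
have eqD (a b c e s : R) : a = b -> c = e -> a + c + s = b + e + s by move=> -> ->.
apply: eqD.
  apply: eq_big => k.
    rewrite /q' ltn_ord; apply/asboolP/asboolP => -[vk ck]; split => //.
      exact/gvisible'.
    exact/gvisible'.
  move=> /asboolP[vk]; rewrite /q' ltn_ord => ck.
  rewrite /greceived gdist'; last exact: ltn_ord.
  rewrite /h'; case: eqP => [[kn]|_]; last by [].
  exfalso; apply: ck; rewrite kn; split; first by case: vn.
  by rewrite /= lexx.
apply: eq_big => k.
  by apply/asboolP/asboolP; rewrite gvisible'.
move=> _; rewrite /greceived gdist'; last exact: ltn_ord.
by rewrite /h'; case: eqP => [[]|_]; [case: o k|].
Qed.

Lemma tail_fixed_label (o : mode) (phi : R * R -> R) :
  measurable_fun setT phi ->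
  P (gnearest p np q n `&` [set w |
     let t := phi (gdist p q Sat n w,
                   ginterference p np q h o (gdist p q Sat n w) w) in
     0 <= t /\ t < h Sat n w]) =
  (\int[P]_(w in gnearest p np q n) (sr_ccdf_pos
     (phi (gdist p q Sat n w,
           ginterference p np q h o (gdist p q Sat n w) w)))%:E)%E.
Proof.
move=> mphi.
set A := gnearest p np q n.
pose t w := phi (gdist p q Sat n w, ginterference p np q h o (gdist p q Sat n w) w).
(* Which satellite serves is decided by counts and positions alone. *)
have mA : measurable (A : set T') by rewrite /A -gnearest'; apply: measurable_gnearest.
(* The value -1 marks the complement of A, so that t' alone carries A. *)
pose t' (w : T) : R := if `[< A w >] then
  phi (gdist p q' Sat n w, ginterference p np q' h' o (gdist p q' Sat n w) w) else -1.
have t'E w : A w -> t' w = t w.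
  move=> Aw; rewrite /t' asboolT; last exact: Aw.
  rewrite /t (ginterference' _ Aw) gdist'; first by [].
  by case: Aw => -[].
have t'N w : ~ A w -> t' w = -1 by move=> Aw; rewrite /t' asboolF.
have mt' : measurable_fun [set: T'] (t' : T' -> R).
  apply: measurable_fun_ifT => //.
    apply: (measurable_fun_bool true); rewrite setTI.
    by rewrite (_ : _ @^-1` _ = A)//; apply/seteqP; split => w /= /asboolP.
  apply: (measurableT_comp mphi); apply: measurable_fun_pair.
    by apply: measurable_gdist; exact: mq.
  by apply: measurable_ginterference => //; apply: measurable_gdist; exact: mq.
have GT : <<s G >> `<=` measurable.
  apply: smallest_sub; first exact: sigma_algebra_measurable.
  by move=> B [i _]; exact: source_sigma_measurable.
have mt'T : measurable_fun [set: T] t'.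
  move=> _ B mB; rewrite setTI; apply: GT.
  by have := mt' measurableT B mB; rewrite setTI.
pose X : {RV P >-> R} := mfun_Sub (mem_set mt'T).
have mD : measurable [set z : R * R | 0 <= z.1 /\ z.1 < z.2].
  rewrite (_ : [set z : R * R | _] = (fst @^-1` `[0, +oo[) `&`
      ((fun z => z.1 - z.2) @^-1` `]-oo, 0[)).
    apply: measurableI; rewrite -[X in measurable X]setTI.
      by apply: measurable_fst.
    by apply: measurable_funB.
  by apply/seteqP; split => z /=; rewrite !in_itv /= andbT subr_lt0.
have ind (B C : set R) : measurable B -> measurable C ->
    P (X @^-1` B `&` fading N Sat n @^-1` C) =
    (P (X @^-1` B) * P (fading N Sat n @^-1` C))%E.
  move=> mB mC.
  apply: (@independent_rest _ _ _ P (layer * option nat)%type (source_sigma N) (Sat, Some n)).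
  - exact: sources_independent Nm.
  - exact: source_sigma_measurable.
  - exact: source_sigmaI.
  - exact: source_sigmaT.
  - by have := mt' measurableT B mB; rewrite setTI.
  - by exists C.
have key : P [set w | 0 <= t' w /\ t' w < h Sat n w] =
    (\int[P]_w P [set w' | (0 <= t' w)%R /\ (t' w < h Sat n w')%R])%E.
  exact: (independent_RV_joint ind mD).
transitivity (P [set w | 0 <= t' w /\ t' w < h Sat n w]).
  congr (P _); apply/seteqP; split => w /=.
    by move=> [Aw]; rewrite -/(t w) -(t'E w Aw).
  have [Aw|nAw] := pselect (A w); first by rewrite (t'E w Aw).
  by rewrite (t'N w nAw) lerNr oppr0 ler10 => -[].
rewrite key.
rewrite [RHS]integral_mkcond; apply: eq_integral => w _ /=.
rewrite sr_ccdf_pos_fading patchE; case: ifPn => [/set_mem Aw|/negP nAw].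
  by rewrite (t'E w Aw).
rewrite t'N; last by move=> Aw; apply: nAw; rewrite inE.
by rewrite /sr_ccdf_pos lerNr oppr0 ler10.
Qed.

End fixed_label.

(** The events that label n serves partition [E]. The fixed-label identity holds on each of them,
    and the countably many pieces add up. *)
Lemma tail_serving (o : mode) (phi : R * R -> R) :
  measurable_fun setT phi ->
  let t w := phi (serving_dist p N w,
                  interference_noise p N o (serving_dist p N w) w) in
  P (E `&` [set w | 0 <= t w /\ t w < h Sat (serving p N w) w]) =
  (\int[P]_(w in E) (sr_ccdf_pos (t w))%:E)%E.
Proof.
move=> mphi t.
have mt : measurable_fun setT t.
  apply: (measurableT_comp mphi); apply: measurable_fun_pair.
    exact: measurable_serving_dist.
  exact: measurable_interference_noise.
have EE := some_visible_bigcup p N.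
have trivA : trivIset setT (fun n => gnearest p np q n).
  by move=> i j _ _ [w [wi wj]]; exact: gnearest_uniq wi wj.
have mA n : measurable (gnearest p np q n) by exact: measurable_gnearestN.
have mS : measurable [set w | 0 <= t w /\ t w < h Sat (serving p N w) w].
  rewrite (_ : [set w | _] = (t @^-1` `[0, +oo[) `&`
      ((fun w => t w - h Sat (serving p N w) w) @^-1` `]-oo, 0[)).
    apply: measurableI; rewrite -[X in measurable X]setTI; first exact: mt.
    by apply: measurable_funB => //; exact: measurable_serving_fading.
  by apply/seteqP; split => w /=; rewrite !in_itv /= andbT subr_lt0.
rewrite /E EE setI_bigcupl measure_bigcup//; last 2 first.
- by move=> n _; exact: measurableI.
- exact: trivIset_setIr.
rewrite ge0_integral_bigcup//; last 2 first.
- apply/measurable_EFinP; apply: measurable_funTS.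
  exact: (measurableT_comp measurable_sr_ccdf_pos).
- by move=> w _; rewrite lee_fin sr_ccdf_pos_ge0.
rewrite (eq_eseriesl (Q := xpredT)); last by move=> n; rewrite in_setT.
apply: eq_eseriesr => n _.
have sE w : gnearest p np q n w -> serving p N w = n by exact: gnearest_serving.
have tE w : gnearest p np q n w -> t w = phi (gdist p q Sat n w,
    ginterference p np q h o (gdist p q Sat n w) w).
  by move=> nw; rewrite /t /serving_dist (sE w nw).
apply: (etrans _ (etrans (tail_fixed_label n o mphi) _)).
  by congr (P _); apply/seteqP; split => w /= [nw];
    rewrite (tE w nw) (sE w nw).
by apply: eq_integral => w /set_mem nw; rewrite (tE w nw).
Qed.

End tail_given_sources.

(** * Conditional laws *)

Section ge0_functionals.
Context d (T : measurableType d) (R : realType).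
Local Open Scope ereal_scope.

(** What integrals against densities, laws and kernels have in common: both sides of an identity
    between them are such functionals, so it can be checked on indicators. *)
Definition ge0_functional (I : (T -> \bar R) -> \bar R) : Prop :=
  [/\ forall f g, measurable_fun setT f -> (forall x, 0 <= f x) ->
        measurable_fun setT g -> (forall x, 0 <= g x) ->
        I (fun x => f x + g x) = I f + I g,
      forall (c : R) f, (0 <= c)%R -> measurable_fun setT f ->
        (forall x, 0 <= f x) -> I (fun x => c%:E * f x) = c%:E * I f &
      forall F : nat -> T -> \bar R, (forall n, measurable_fun setT (F n)) ->
        (forall n x, 0 <= F n x) -> (forall x, nondecreasing_seq (F ^~ x)) ->
        I (fun x => limn (F ^~ x)) = limn (fun n => I (F n))].

Variables I J : (T -> \bar R) -> \bar R.
Hypotheses (fI : ge0_functional I) (fJ : ge0_functional J).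

Lemma ge0_functional_eq :
  (forall A, measurable A -> I (EFin \o \1_A) = J (EFin \o \1_A)) ->
  forall f, measurable_fun setT f -> (forall x, 0 <= f x) -> I f = J f.
Proof.
have [ID IZ Ilim] := fI; have [JD JZ Jlim] := fJ.
move=> IJ; apply: ge0_measurable_ind.
- exact: IJ.
- by move=> c f c0 mf f0 e; rewrite IZ// JZ// e.
- by move=> f g mf f0 ef mg g0 eg; rewrite ID// JD// ef eg.
- move=> F mF F0 eF ndF; rewrite Ilim// Jlim//.
  by congr (limn _); apply/funext => n.
Qed.

(** Agreement on a pi-system spreads to all measurable sets by Dynkin's theorem, then to functions
    by [ge0_functional_eq]. *)
Lemma ge0_functional_unique (G : set (set T)) :
  measurable = <<s G >> -> setI_closed G -> G setT ->
  I (cst 1) \is a fin_num ->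
  (forall A, G A -> I (EFin \o \1_A) = J (EFin \o \1_A)) ->
  forall f, measurable_fun setT f -> (forall x, 0 <= f x) -> I f = J f.
Proof.
move=> mG GI GT I1 IJG; apply: ge0_functional_eq => A mA.
have [ID IZ Ilim] := fI; have [JD JZ Jlim] := fJ.
have m1 B : measurable B -> measurable_fun setT (EFin \o \1_B : T -> \bar R).
  by move=> mB; exact/measurable_EFinP/measurable_indic.
have p1 (B : set T) x : 0 <= (EFin \o \1_B : T -> \bar R) x by rewrite /= lee_fin.
have e1 : cst 1 = EFin \o \1_(setT : set T) :> (T -> \bar R).
  by apply/funext => x /=; rewrite indicT.
move: (mA); rewrite mG; apply: (@dynkin_induction _ T G
  [set B | I (EFin \o \1_B) = J (EFin \o \1_B)]) => //=.
- exact: IJG.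
- move=> B mB eB.
  have eT : cst 1 = (fun x => (EFin \o \1_B) x + (EFin \o \1_(~` B)) x) :> (T -> \bar R).
    apply/funext => x /=; rewrite -EFinD !indicE in_setC.
    by case: (x \in B); rewrite /= ?addr0 ?add0r.
  have mBC := measurableC mB.
  have hI : I (cst 1) = I (EFin \o \1_B) + I (EFin \o \1_(~` B)).
    by rewrite eT ID//; exact: m1.
  have hJ : J (cst 1) = J (EFin \o \1_B) + J (EFin \o \1_(~` B)).
    by rewrite eT JD//; exact: m1.
  (* Finiteness of I(1) allows the common value on B to be cancelled, which yields the
     complement. *)
  have IB : I (EFin \o \1_B) \is a fin_num.
    by move: I1; rewrite hI fin_numD => /andP[].
  have := IJG _ GT; rewrite -e1 hI hJ -eB => h.
  have {}h : I (EFin \o \1_(~` B)) + I (EFin \o \1_B) =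
      J (EFin \o \1_(~` B)) + I (EFin \o \1_B) by rewrite addeC h addeC.
  by rewrite -[LHS](addeK _ IB) h addeK.
- move=> F mF tF eF.
  pose S n (x : T) : \bar R := \sum_(0 <= i < n) (EFin \o \1_(F i)) x.
  have Sprop n : [/\ measurable_fun setT (S n), forall x, 0 <= S n x & I (S n) = J (S n)].
    elim: n => [|n [mS S0 eS]].
      (* The value at the zero function is derived from homogeneity with factor 0. *)
      have S00 : S 0%N = (fun x => 0%:E * (EFin \o \1_(setT : set T)) x).
        by apply/funext => x; rewrite /S big_nil mul0e.
      split.
      - by rewrite S00; apply: measurable_funeM; exact: m1.
      - by move=> x; rewrite S00 mul0e.
      - by rewrite S00 IZ// ?JZ// ?mul0e//; exact: m1.
    have SS : S n.+1 = (fun x => S n x + (EFin \o \1_(F n)) x).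
      by apply/funext => x; rewrite /S big_nat_recr.
    have mFn := m1 _ (mF n).
    split.
    - by rewrite SS; exact: emeasurable_funD.
    - by move=> x; rewrite SS adde_ge0.
    - by rewrite SS ID// JD// eS eF.
  have limS : EFin \o \1_(\bigcup_k F k) = (fun x => limn (S ^~ x)).
    by apply/funext => x /=; rewrite indic_bigcup.
  have ndS x : nondecreasing_seq (S ^~ x).
    by move=> m n mn; apply: lee_sum_nneg_natr => // k _ _; exact: p1.
  have mS n : measurable_fun setT (S n) by have [] := Sprop n.
  have S0 n x : 0 <= S n x by have [_] := Sprop n.
  rewrite limS Ilim// Jlim//.
  by congr (limn _); apply/funext => n; have [] := Sprop n.
Qed.

End ge0_functionals.

Section functional_instances.
Context d (T : measurableType d) (R : realType).
Local Open Scope ereal_scope.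

Lemma ge0_functional_integral (mu : {measure set T -> \bar R}) (w : T -> R) :
  measurable_fun setT w -> (forall x, 0 <= w x)%R ->
  ge0_functional (fun f => \int[mu]_x ((w x)%:E * f x)).
Proof.
move=> mw' w0; have mw : measurable_fun setT (EFin \o w) by exact/measurable_EFinP.
have wE0 x : 0 <= (w x)%:E by rewrite lee_fin.
split.
- move=> f g mf f0 mg g0.
  under eq_integral do rewrite ge0_muleDr//.
  rewrite ge0_integralD//.
  + by move=> x _; rewrite mule_ge0.
  + exact: emeasurable_funM.
  + by move=> x _; rewrite mule_ge0.
  + exact: emeasurable_funM.
- move=> c f c0 mf f0.
  under eq_integral do rewrite muleCA.
  rewrite ge0_integralZl//; first exact: emeasurable_funM.
  by move=> x _; rewrite mule_ge0.
- move=> F mF F0 ndF.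
  rewrite -monotone_convergence//.
  + apply: eq_integral => x _; rewrite limeMl//.
    by apply: ereal_nondecreasing_is_cvgn => m n mn; exact: ndF.
  + by move=> n; exact: emeasurable_funM.
  + by move=> n x _; rewrite mule_ge0.
  + by move=> x _ m n mn; rewrite lee_wpmul2l// ndF.
Qed.

End functional_instances.

Section conditional_laws.
Context (R : realType) (d : measure_display) (T : measurableType d).
Context (P : probability T R) (E : set T) (X Y : T -> R).
Hypothesis mE : measurable E.
Hypothesis mX : measurable_fun setT X.
Hypothesis mY : measurable_fun setT Y.
Local Open Scope ereal_scope.

Lemma integral_cond_density (f : R -> R) (g : R -> \bar R) :
  is_cond_density P E X f -> measurable_fun setT g -> (forall x, 0 <= g x) ->
  \int[P]_(w in E) g (X w) = P E * \int[lebesgue_measure]_r ((f r)%:E * g r).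
Proof.
move=> [mf f0 fE] mg g0.
pose c := fine (P E); have cE : c%:E = P E by rewrite fineK// fin_num_measure.
have c0 : (0 <= c)%R by rewrite fine_ge0.
have mfE : measurable_fun setT (EFin \o f) by exact/measurable_EFinP.
transitivity (\int[lebesgue_measure]_r ((c * f r)%:E * g r)); last first.
  under eq_integral do rewrite EFinM -muleA.
  rewrite ge0_integralZl//.
  - by rewrite cE.
  - exact: emeasurable_funM.
  - by move=> x _; rewrite mule_ge0 ?lee_fin.
transitivity (\int[P]_w ((\1_E w)%:E * g (X w))).
  rewrite integral_mkcond; apply: eq_integral => w _; rewrite patchE indicE.
  by case: ifPn; rewrite ?mul1e ?mul0e.
have m1E : measurable_fun setT (\1_E : T -> R) by exact: measurable_indic.
pose I (g : R -> \bar R) := \int[P]_w ((\1_E w)%:E * g (X w)).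
pose J (g : R -> \bar R) := \int[lebesgue_measure]_r ((c * f r)%:E * g r).
rewrite -/(I g) -/(J g); apply: (ge0_functional_eq (I := I) (J := J)) => //.
- have [h1 h2 h3] := ge0_functional_integral P m1E (fun x => ler0n _ _ : (0 <= \1_E x)%R).
  have cm (u : R -> \bar R) : measurable_fun setT u -> measurable_fun setT (u \o X).
    by move=> mu; exact: (measurableT_comp mu mX).
  rewrite /I; split.
  + move=> u v mu u0 mv v0.
    exact: (h1 _ _ (cm u mu) (fun w => u0 (X w)) (cm v mv) (fun w => v0 (X w))).
  + by move=> k u k0 mu u0; exact: (h2 k _ k0 (cm u mu) (fun w => u0 (X w))).
  + move=> F mF F0 ndF.
    exact: (h3 _ (fun n => cm (F n) (mF n)) (fun n w => F0 n (X w)) (fun w => ndF (X w))).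
- apply: (@ge0_functional_integral _ _ _ lebesgue_measure (fun r => c * f r)%R).
    exact: measurable_funM.
  by move=> x; rewrite mulr_ge0.
- move=> B mB; rewrite /I /J.
  transitivity (P (E `&` X @^-1` B)).
    have mXB : measurable (X @^-1` B) by rewrite -[X in measurable X]setTI; exact: mX.
    rewrite -[P _]mul1e -integral_cst//; last exact: measurableI.
    rewrite [RHS]integral_mkcond; apply: eq_integral => w _.
    rewrite patchE /= !indicE in_setI -EFinM (_ : (w \in _ @^-1` _) = (X w \in B)); last first.
      by apply/idP/idP; rewrite !inE.
    by case: (w \in E); case: (X w \in B); rewrite /= ?mulr1 ?mulr0.
  rewrite fE// -cE -ge0_integralZl//; last 2 first.
  - exact: measurable_funTS mfE.
  - by move=> r _; rewrite lee_fin.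
  rewrite integral_mkcond; apply: eq_integral => r _.
  rewrite patchE /= indicE; case: ifPn => _; first by rewrite mulr1n mule1 EFinM.
  by rewrite mulr0n mule0.
Qed.

(** [is_cond_law] speaks of rectangles only; these form a pi-system generating the product
    sigma-algebra, and P(E) is finite. *)
Lemma integral_cond_law
    (kappa : R.-pker (measurableTypeR R) ~> (measurableTypeR R))
    (phi : R * R -> \bar R) :
  is_cond_law P E X Y kappa -> measurable_fun setT phi -> (forall z, 0 <= phi z) ->
  \int[P]_(w in E) phi (X w, Y w) =
  \int[P]_(w in E) \int[kappa (X w)]_y phi (X w, y).
Proof.
move=> kE.
have m1E : measurable_fun setT (\1_E : T -> R) by exact: measurable_indic.
have fP := ge0_functional_integral P m1E (fun x => ler0n _ _ : (0 <= \1_E x)%R).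
have [h1 h2 h3] := fP.
have mXY : measurable_fun setT (fun w => (X w, Y w)) by exact: measurable_fun_pair.
pose K (phi : R * R -> \bar R) (w : T) := \int[kappa (X w)]_y phi (X w, y).
have mK (u : R * R -> \bar R) : measurable_fun setT u -> (forall z, 0 <= u z) ->
    measurable_fun setT (K u).
  move=> mu u0; apply: (@measurableT_comp _ _ _ _ _ _ (kfcomp kappa u)) => //.
  exact: measurable_kfcomp.
have K0 (u : R * R -> \bar R) w : (forall z, 0 <= u z) -> 0 <= K u w.
  by move=> u0; apply: integral_ge0.
have mpair (u : R * R -> \bar R) x : measurable_fun setT u ->
    measurable_fun setT (fun y => u (x, y)).
  by move=> mu; apply: (measurableT_comp mu); exact: measurable_pair1.
have mk (g : T -> \bar R) : \int[P]_(w in E) g w = \int[P]_w ((\1_E w)%:E * g w).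
  rewrite integral_mkcond; apply: eq_integral => w _; rewrite patchE indicE.
  by case: ifPn; rewrite ?mul1e ?mul0e.
move: phi; rewrite -/(K _).
suff : forall phi, measurable_fun setT phi -> (forall z, 0 <= phi z) ->
    \int[P]_w ((\1_E w)%:E * phi (X w, Y w)) = \int[P]_w ((\1_E w)%:E * K phi w).
  by move=> h phi mphi phi0; rewrite mk [RHS]mk; exact: h.
apply: (@ge0_functional_unique _ _ _
  (fun phi => \int[P]_w ((\1_E w)%:E * phi (X w, Y w)))
  (fun phi => \int[P]_w ((\1_E w)%:E * K phi w)) _ _
  [set A `*` B | A in measurable & B in measurable]).
- have cm (u : R * R -> \bar R) : measurable_fun setT u ->
      measurable_fun setT (fun w => u (X w, Y w)).
    by move=> mu; exact: (measurableT_comp mu mXY).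
  split.
  + move=> u v mu u0 mv v0.
    exact: (h1 _ _ (cm u mu) (fun w => u0 _) (cm v mv) (fun w => v0 _)).
  + by move=> k u k0 mu u0; exact: (h2 k _ k0 (cm u mu) (fun w => u0 _)).
  + move=> F mF F0 ndF.
    exact: (h3 _ (fun n => cm (F n) (mF n)) (fun n w => F0 n _) (fun w => ndF _)).
- split.
  + move=> u v mu u0 mv v0; rewrite -(h1 (K u) (K v)) ?K0//; try exact: mK.
    * by apply: eq_integral => w _; rewrite /K ge0_integralD//; exact: mpair.
    * by move=> w; exact: K0.
    * by move=> w; exact: K0.
  + move=> k u k0 mu u0; rewrite -(h2 k (K u))//; last 2 first.
    * exact: mK.
    * by move=> w; exact: K0.
    by apply: eq_integral => w _; rewrite /K ge0_integralZl//; exact: mpair.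
  + move=> F mF F0 ndF; rewrite -(h3 (fun n => K (F n)))//.
    * apply: eq_integral => w _; rewrite /K monotone_convergence//.
      by move=> n; exact: mpair.
    * by move=> n; exact: mK.
    * by move=> n w; exact: K0.
    * move=> w m n mn; apply: ge0_le_integral => //; try exact: mpair.
      by move=> y _; exact: ndF.
- exact: measurable_prod_measurableType.
- move=> _ _ [A1 mA1 [B1 mB1 <-]] [A2 mA2 [B2 mB2 <-]].
  exists (A1 `&` A2); first exact: measurableI.
  exists (B1 `&` B2); first exact: measurableI.
  by rewrite setXI.
- by exists setT => //; exists setT => //; rewrite setXTT.
- rewrite -mk integral_cst// mul1e fin_num_measure//.
- move=> _ [A mA [B mB <-]].
  have mXA : measurable (X @^-1` A) by rewrite -[X in measurable X]setTI; exact: mX.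
  have mYB : measurable (Y @^-1` B) by rewrite -[X in measurable X]setTI; exact: mY.
  transitivity (P (E `&` X @^-1` A `&` Y @^-1` B)).
    rewrite -[P _]mul1e -integral_cst//; last by apply: measurableI => //; exact: measurableI.
    rewrite [RHS]integral_mkcond; apply: eq_integral => w _.
    rewrite patchE /= !indicE in_setX /= !in_setI -EFinM.
    rewrite (_ : (w \in X @^-1` _) = (X w \in A)); last by apply/idP/idP; rewrite !inE.
    rewrite (_ : (w \in Y @^-1` _) = (Y w \in B)); last by apply/idP/idP; rewrite !inE.
    by case: (w \in E); case: (X w \in A); case: (Y w \in B); rewrite /= ?mulr1 ?mulr0 ?mul0r.
  rewrite kE// integral_mkcond; apply: eq_integral => w _.
  rewrite patchE in_setI indicE /K.
  rewrite (_ : (w \in X @^-1` _) = (X w \in A)); last by apply/idP/idP; rewrite !inE.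
  case: (w \in E); last by rewrite mul0e.
  rewrite /= mul1e.
  have mB' : measurable (B : set (measurableTypeR R)) by [].
  case: (boolP (X w \in A)) => XA.
    rewrite -[LHS]mul1e -(integral_cst _ mB') integral_mkcond.
    apply: eq_integral => y _; rewrite patchE /= indicE in_setX /= XA.
    by case: (y \in B).
  rewrite integral0_eq// => y _ /=; rewrite indicE in_setX /=.
  by rewrite (negbTE XA).
Qed.

End conditional_laws.

(** * Spectral efficiency *)

Section log_integral.
Context (R : realType).

Lemma ln2_gt0 : 0 < ln 2 :> R.
Proof. by rewrite ln_gt0// ltr1n. Qed.

(** The domain is the set of g >= 0 with g < v: this turns log2(1 + SINR) into an integral over the
    events SINR > g. *)
Lemma log2_integral (v : R) : 0 <= v ->
  (\int[lebesgue_measure]_(g in `[0%R, v[) (log2 (expR 1) / (1 + g))%:E =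
   (log2 (1 + v))%:E)%E.
Proof.
have l2 := ln2_gt0.
rewrite le_eqVlt => /predU1P[<-|v0].
  by rewrite set_itv_ge ?bnd_simp ?ltxx// integral_set0 addr0 /log2 ln1 mul0r.
pose f (g : R) := log2 (expR 1) / (1 + g).
pose F (g : R) := log2 (expR 1) * ln (1 + g).
have dF (x : R) : 0 <= x -> is_derive x 1 F (f x).
  move=> x0; have x1 : 0 < 1 + x by rewrite ltr_wpDr.
  have d1 : is_derive x 1 (fun y : R => 1 + y) 1.
    have := is_deriveD (is_derive_cst (1 : R) x 1) (is_derive_id x (1 : R)).
    by rewrite add0r.
  have d2 := @is_derive1_comp R (@ln R) (fun y => 1 + y) x _ _ (is_derive1_ln x1) d1.
  apply: (is_derive_eq (is_deriveZ (log2 (expR 1)) d2)).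
  by rewrite /GRing.scale /= mulr1.
have cF (x : R) : 0 <= x -> {for x, continuous F}.
  move=> x0; apply: differentiable_continuous; apply/derivable1_diffP.
  by have [] := dF x x0.
have cf : {within `[0, v], continuous f}.
  apply: continuous_in_subspaceT => x; rewrite inE /= in_itv /= => /andP[x0 _].
  apply: cvgM; first exact: cvg_cst.
  apply: cvgV; first by rewrite gt_eqF// ltr_wpDr.
  by apply: cvgD; [exact: cvg_cst|exact: cvg_id].
rewrite integral_itv_bndo_bndc; last first.
  apply/measurable_EFinP; apply: (@measurable_funS _ _ _ _ `[0, v]%classic) => //.
    by apply: subset_itvl; rewrite bnd_simp.
  exact: subspace_continuous_measurable_fun.
rewrite (@continuous_FTC2 _ f F)//.
- rewrite /F addr0 ln1 mulr0 sube0 /log2 expRK mul1r mulrC.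
  by [].
- split=> [x||].
  + by rewrite in_itv /= => /andP[x0 _]; have [] := dF x (ltW x0).
  + exact/cvg_at_right_filter/cF.
  + exact/cvg_at_left_filter/cF/ltW.
- by move=> x; rewrite in_itv /= => /andP[x0 _]; rewrite derive1E; have [] := dF x (ltW x0).
Qed.

End log_integral.

(** * The SINR outside a null event *)

Section pathwise.
Context (R : realType) (d : measure_display) (T : measurableType d).
Context (P : probability T R) (p : params R) (N : network P) (o : mode).
Hypothesis pv : valid_params p.
Hypothesis Nm : network_model p N.

Let np (l : layer) : T -> nat := npt (points N l).
Let q (l : layer) (n : nat) : T -> R * R * R := pt (points N l) n.
Let h (l : layer) (n : nat) : T -> R := fading N l n.
Let E := some_visible p N.
Let X := serving_dist p N.
Let Y w := interference_noise p N o (X w) w.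
Let H w := h Sat (serving p N w) w.

(** Off this event all received powers are nonnegative and no other visible satellite is at the
    serving distance. *)
Definition exceptional : set T :=
  sat_tie p N `|` \bigcup_n \bigcup_(l in [set: layer]) [set w | h l n w <= 0].

Lemma exceptional_negligible : P.-negligible exceptional.
Proof.
apply: negligibleU; first exact: sat_tie_negligible.
apply: negligible_bigcup => n.
rewrite (_ : \bigcup_(l in _) _ = [set w | h Sat n w <= 0] `|`
    ([set w | h Bs n w <= 0] `|` [set w | h Ut n w <= 0])).
  have neg l : P.-negligible [set w | h l n w <= 0].
    apply/negligibleP; last exact: (fading_le0_negligible Nm).
    rewrite (_ : [set w | _] = h l n @^-1` `]-oo, 0]).
      by rewrite -[X in measurable X]setTI; exact: measurable_funP.
    by apply/seteqP; split => w /=; rewrite in_itv.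
  by apply: negligibleU => //; exact: negligibleU.
apply/seteqP; split => w.
  by move=> [[] _ hl]; [left|right; left|right; right].
by move=> [hl|[hl|hl]]; [exists Sat|exists Bs|exists Ut].
Qed.

Lemma fading_gt0 l n w : ~ exceptional w -> 0 < h l n w.
Proof.
by move=> nw; rewrite ltNge; apply/negP => hl; apply: nw; right; exists n => //; exists l.
Qed.

Lemma gain_side_gt0 l : 0 < gain_side p l.
Proof.
rewrite /gain_side mulr_gt0//.
  by rewrite mulr_gt0 ?(Gus_side_gt0 pv)//; case: l;
    [exact: Gs_side_gt0|exact: Gb_side_gt0|exact: Gut_side_gt0].
by rewrite exprn_gt0// divr_gt0 ?(c_0_gt0 pv)// mulr_gt0 ?(f_c_gt0 pv)// mulr_gt0 ?pi_gt0.
Qed.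

Lemma gain_main_gt0 : 0 < gain_main_s p.
Proof.
rewrite /gain_main_s mulr_gt0//.
  by rewrite mulr_gt0 ?(Gus_main_gt0 pv) ?(Gs_main_gt0 pv).
by rewrite exprn_gt0// divr_gt0 ?(c_0_gt0 pv)// mulr_gt0 ?(f_c_gt0 pv)// mulr_gt0 ?pi_gt0.
Qed.

Lemma power_gt0 l : 0 < power p l.
Proof. by case: l; [exact: P_s_gt0|exact: P_b_gt0|exact: P_ut_gt0]. Qed.

Lemma serving_dist_itv w : E w -> Rmin_s p <= X w <= Rmax_s p.
Proof.
move=> Ew; have [[_ vs] _] := servingP Ew.
exact: (visible_sat_dist pv vs).
Qed.

Lemma serving_dist_gt0 w : E w -> 0 < X w.
Proof.
by move=> /serving_dist_itv/andP[h1 _]; rewrite (lt_le_trans (Rmin_gt0 pv)).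
Qed.

Lemma received_ge0 l w n : ~ exceptional w -> 0 <= received p N l w n.
Proof.
move=> nw; rewrite /received mulr_ge0 ?powR_ge0// mulr_ge0// ltW//.
  exact: power_gt0.
exact: fading_gt0.
Qed.

Lemma interference_noise_gt0 r w : ~ exceptional w ->
  0 < interference_noise p N o r w.
Proof.
move=> nw; rewrite /interference_noise ltr_wpDl// ?(sigma2_gt0 pv)//.
rewrite addr_ge0// /interference_ter; apply: sumr_ge0 => n _;
  by rewrite mulr_ge0 ?received_ge0// ltW// gain_side_gt0.
Qed.

(** The left side omits the serving label, the right side every satellite within the serving
    distance. By minimality of that distance the two differ only at a tie. *)
Lemma interference_satE w : E w -> ~ exceptional w ->
  interference_sat p N w + interference_ter p N o w + sigma2 p = Y w.
Proof.
move=> Ew nw; rewrite /Y /interference_noise; congr (_ + _ + _).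
have [[ns vs] hs] := servingP Ew.
apply: eq_bigl => n.
apply/andP/asboolP.
  move=> [/asboolP vn ne]; split => // -[_ /= dn].
  have [lt|[eqd _]] := hs n vn; first by move: dn; rewrite leNgt lt.
  apply: nw; left; exists (nat_of_ord n), (serving p N w); split => //.
move=> [vn nc]; split; first exact/asboolP.
apply/eqP => en; apply: nc; split; first by case: vn => _ [].
by rewrite /= en.
Qed.

(** The inequality SINR > g solved for the serving fading, with z the pair of serving distance and
    interference plus noise. *)
Definition sinr_threshold (g : R) (z : R * R) : R :=
  g * z.1 `^ alpha_s p * z.2 / (gain_main_s p * P_s p).

Lemma SINR_gt w g : E w -> ~ exceptional w ->
  0 <= SINR p N o w /\
  (0 <= g -> (g < SINR p N o w) =
     (0 <= sinr_threshold g (X w, Y w) < H w)).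
Proof.
move=> Ew nw; rewrite /SINR asboolT// interference_satE//.
have Y0 : 0 < Y w by exact: interference_noise_gt0.
have G0 := gain_main_gt0; have P0 := P_s_gt0 pv.
have X0 : 0 < X w `^ alpha_s p by rewrite powR_gt0// serving_dist_gt0.
have H0 : 0 < H w by exact: fading_gt0.
rewrite /received /power /alpha -/(H w) powRN.
rewrite (_ : dist_to p N Sat w (serving p N w) = X w)//.
split.
  apply: mulr_ge0; last by rewrite invr_ge0 ltW.
  apply: mulr_ge0; first exact: ltW.
  by apply: mulr_ge0; [apply: mulr_ge0; exact: ltW|rewrite invr_ge0 ltW].
have GP0 : 0 < gain_main_s p * P_s p by exact: mulr_gt0.
move=> g0; rewrite /sinr_threshold /=.
have -> /= : 0 <= g * X w `^ alpha_s p * Y w / (gain_main_s p * P_s p).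
  by apply: divr_ge0; [apply: mulr_ge0; [apply: mulr_ge0|]|]; rewrite // ltW.
rewrite ltr_pdivlMr// ltr_pdivrMr//.
rewrite -[RHS](ltr_pM2r (x := (X w `^ alpha_s p)^-1)) ?invr_gt0//.
rewrite -[fading N Sat _ w]/(H w); congr (_ < _); last by ring.
by field; rewrite gt_eqF.
Qed.

Lemma log2_SINR_integral w : ~ exceptional w ->
  (log2 (1 + SINR p N o w))%:E =
  (\int[lebesgue_measure]_(g in `[0%R, +oo[)
     ((\1_[set z : T * R | [/\ E z.1, 0 <= sinr_threshold z.2 (X z.1, Y z.1) &
                            sinr_threshold z.2 (X z.1, Y z.1) < H z.1]] (w, g))%:E *
      (log2 (expR 1) / (1 + `|g|))%:E))%E.
Proof.
move=> nw; have [Ew|nEw] := pselect (E w); last first.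
  rewrite /SINR asboolF// addr0 /log2 ln1 mul0r integral0_eq// => g _.
  by rewrite indicE memNset ?mul0e// => -[].
have [S0 _] := SINR_gt 0 Ew nw.
rewrite -log2_integral// integral_mkcond [RHS]integral_mkcond.
apply: eq_integral => g _; rewrite !patchE.
case: (boolP (g \in `[0, +oo[%classic)) => [|].
  rewrite inE /= in_itv /= andbT => g0.
  have [_ /(_ g0) Sg] := SINR_gt g Ew nw.
  rewrite ger0_norm// indicE.
  case: ifPn => [/set_mem|/negP gS].
    by rewrite /= in_itv /= g0 /= Sg => /andP[h1 h2]; rewrite mem_set ?mul1e.
  rewrite memNset ?mul0e// => -[_ h2 h3]; apply: gS.
  by rewrite inE /= in_itv /= g0 /= Sg h2.
move=> /negP g0; rewrite memNset//= in_itv /= => /andP[g1 _]; apply: g0.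
by rewrite inE /= in_itv /= g1.
Qed.

End pathwise.

Section spectral_efficiency.
Context (R : realType) (d : measure_display) (T : measurableType d).
Context (P : probability T R) (p : params R) (N : network P) (o : mode).
Context (f : R -> R)
  (kappa : R.-pker (measurableTypeR R) ~> (measurableTypeR R)).
Hypothesis pv : valid_params p.
Hypothesis Nm : network_model p N.
Hypothesis f_density : nearest_distance_density p N f.
Hypothesis kappa_law : interference_cond_law p N o kappa.

Let E := some_visible p N.
Let X := serving_dist p N.
Let Y w := interference_noise p N o (X w) w.
Let H w := fading N Sat (serving p N w) w.
Let thr := sinr_threshold p.
(* The absolute value makes the weight continuous; only g >= 0 matters. *)
Let wt (g : R) : R := log2 (expR 1) / (1 + `|g|).
Let S : set (T * R) := [set z : T * R |
  [/\ E z.1, 0 <= thr z.2 (X z.1, Y z.1) & thr z.2 (X z.1, Y z.1) < H z.1]].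
Let Q (g : R) := P (E `&` [set w | 0 <= thr g (X w, Y w) /\
                                   thr g (X w, Y w) < H w]).
Let Phi (g r : R) := (\int[kappa r]_y (sr_ccdf_pos p (thr g (r, y)))%:E)%E.
Let J (g : R) := (\int[lebesgue_measure]_(r in `[Rmin_s p, Rmax_s p])
  ((f r)%:E * Phi g r))%E.

Let mE : measurable E. Proof. exact: measurable_some_visible. Qed.
Let mX : measurable_fun setT X. Proof. exact: measurable_serving_dist. Qed.
Let mY : measurable_fun setT Y. Proof. exact: measurable_interference_noise. Qed.
Let mH : measurable_fun setT H. Proof. exact: measurable_serving_fading. Qed.

Let wt_ge0 g : 0 <= wt g.
Proof.
rewrite /wt divr_ge0 ?addr_ge0// /log2 expRK div1r invr_ge0.
exact/ltW/ln2_gt0.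
Qed.

Let mwt : measurable_fun setT wt.
Proof.
apply: measurable_funM => //; apply: continuous_measurable_fun => x.
apply: cvgV; first by rewrite gt_eqF// ltr_wpDr.
by apply: cvgD; [exact: cvg_cst|exact: norm_continuous].
Qed.

Let mthr d' (T1 : measurableType d') (a b c : T1 -> R) :
  measurable_fun setT a -> measurable_fun setT b -> measurable_fun setT c ->
  measurable_fun setT (fun z => thr (a z) (b z, c z)).
Proof.
move=> ma mb mc; apply: measurable_funM => //; apply: measurable_funM => //.
by apply: measurable_funM => //; exact: (measurableT_comp (measurable_powR _) mb).
Qed.

Let mS : measurable S.
Proof.
have mt : measurable_fun setT (fun z : T * R => thr z.2 (X z.1, Y z.1)).
  by apply: mthr => //; exact: (measurableT_comp _ measurable_fst).
rewrite (_ : S = (fst @^-1` E) `&` (((fun z : T * R => thr z.2 (X z.1, Y z.1)) @^-1` `[0, +oo[) `&`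
    ((fun z : T * R => thr z.2 (X z.1, Y z.1) - H z.1) @^-1` `]-oo, 0[))).
  apply: measurableI; first by rewrite -[X in measurable X]setTI; exact: measurable_fst.
  apply: measurableI; rewrite -[X in measurable X]setTI; first exact: mt.
  by apply: measurable_funB => //; exact: (measurableT_comp mH measurable_fst).
apply/seteqP; split => z /=; rewrite !in_itv /= andbT subr_lt0.
  by move=> [].
by move=> [? []].
Qed.

Lemma cond_ccdf_ge0 g r : (0 <= Phi g r)%E.
Proof.
by apply: integral_ge0 => y _; rewrite lee_fin (sr_ccdf_pos_ge0 pv Nm).
Qed.

Lemma measurable_cond_ccdf g : measurable_fun setT (Phi g).
Proof.
apply: (@measurable_kfcomp _ _ _ _ _ kappa (fun z => (sr_ccdf_pos p (thr g (z.1, z.2)))%:E)).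
  apply/measurable_EFinP; apply: (measurableT_comp (@measurable_sr_ccdf_pos _ p)).
  by apply: mthr.
by move=> z; rewrite lee_fin (sr_ccdf_pos_ge0 pv Nm).
Qed.

(** Three integrations in turn: over the serving fading, over the conditional law of the
    interference, over the density of the distance. *)
Lemma SINR_tailE g : Q g = (P E * J g)%E.
Proof.
have mt : measurable_fun setT (thr g).
  apply: (@eq_measurable_fun _ _ _ _ setT (fun z => thr g (z.1, z.2))).
    by move=> [].
  by apply: mthr.
rewrite /Q (tail_serving pv Nm o mt).
have mphi : measurable_fun setT (fun z => (sr_ccdf_pos p (thr g z))%:E).
  by apply/measurable_EFinP; exact: (measurableT_comp (@measurable_sr_ccdf_pos _ p)).
rewrite (integral_cond_law mE mX mY kappa_law mphi); last first.
  by move=> z; rewrite lee_fin (sr_ccdf_pos_ge0 pv Nm).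
(* On [E] the serving distance lies in this interval, so inserting the indicator changes nothing; it
   restricts the integral against [f] without any claim on [f] elsewhere. *)
pose g' r := ((\1_(`[Rmin_s p, Rmax_s p]%classic : set R) r)%:E * Phi g r)%E.
transitivity (\int[P]_(w in E) g' (X w))%E.
  apply: eq_integral => w /set_mem Ew; rewrite /g' indicE mem_set ?mul1e//.
  by rewrite /= in_itv /= serving_dist_itv.
rewrite (integral_cond_density mE mX f_density).
- congr (_ * _)%E; rewrite /J [RHS]integral_mkcond; apply: eq_integral => r _.
  by rewrite patchE /g' indicE; case: ifPn; rewrite ?mul1e// mul0e mule0.
- apply: emeasurable_funM; last exact: measurable_cond_ccdf.
  by apply/measurable_EFinP; exact: measurable_indic.
- by move=> r; rewrite mule_ge0 ?lee_fin// cond_ccdf_ge0.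
Qed.

(** [Q g] is the probability of the g-section of the measurable set [S], so Tonelli's theorem gives
    measurability in g, which [J] then inherits. *)
Lemma measurable_tail : measurable_fun setT Q.
Proof.
have -> : Q = fubini_G P (EFin \o \1_S).
  apply/funext => g; rewrite /Q /fubini_G.
  have mSg : measurable (E `&` [set w | 0 <= thr g (X w, Y w) /\ thr g (X w, Y w) < H w]).
    rewrite (_ : _ `&` _ = (fun w => (w, g)) @^-1` S).
      by rewrite -[X in measurable X]setTI; exact: measurable_pair2.
    by apply/seteqP; split => w /=; [move=> [? []]|move=> []].
  rewrite -[LHS]mul1e -(integral_cst P mSg) [LHS]integral_mkcond.
  apply: eq_integral => w _; rewrite patchE /= indicE.
  rewrite (_ : (w \in _) = ((w, g) \in S)); first by case: ((w, g) \in S).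
  by apply/idP/idP; rewrite !inE /=; [move=> [? []]|move=> []].
apply: measurable_fun_fubini_tonelli_G; last by move=> z; rewrite lee_fin.
by apply/measurable_EFinP; exact: measurable_indic.
Qed.

Lemma expectation_tail :
  ('E_P[fun w => log2 (1 + SINR p N o w)] =
   \int[lebesgue_measure]_(g in `[0%R, +oo[) ((wt g)%:E * Q g))%E.
Proof.
have [M [mM M0 excM]] := exceptional_negligible pv Nm.
pose K (z : T * R) : \bar R := ((\1_S z)%:E *
  ((wt z.2)%:E * (\1_(`[0%R, +oo[%classic : set R) z.2)%:E))%E.
have mK : measurable_fun setT K.
  apply: emeasurable_funM.
    by apply/measurable_EFinP; exact: measurable_indic.
  apply: emeasurable_funM; apply/measurable_EFinP.
    exact: (measurableT_comp mwt measurable_snd).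
  have m1 : measurable_fun setT (\1_(`[0%R, +oo[%classic : set R) : R -> R).
    exact: measurable_indic.
  exact: (measurableT_comp m1 measurable_snd).
have K0 z : (0 <= K z)%E by rewrite /K !mule_ge0 ?lee_fin.
rewrite unlock.
transitivity (\int[P]_w \int[lebesgue_measure]_g K (w, g))%E.
  (* Only the right-hand integrand is known to be measurable here. *)
  apply: (integral_eq_off mM M0) => w _ Mw.
  rewrite log2_SINR_integral//; last by move=> /excM.
  rewrite integral_mkcond; apply: eq_integral => g _.
  rewrite patchE /K /= [\1_(`[0, +oo[%classic) g]indicE.
  by case: ifPn => _; rewrite /= ?mule1 ?mule0.
rewrite (fubini_tonelli (m1 := P) (m2 := lebesgue_measure) K mK K0).
rewrite [RHS]integral_mkcond; apply: eq_integral => g _.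
rewrite patchE; case: (boolP (g \in _)) => [g0|g0]; last first.
  rewrite integral0_eq// => w _.
  by rewrite /K /= [\1_(`[0, +oo[%classic) g]indicE (negbTE g0) !mule0.
have mSg : measurable (E `&` [set w | 0 <= thr g (X w, Y w) /\ thr g (X w, Y w) < H w]).
  rewrite (_ : _ `&` _ = (fun w => (w, g)) @^-1` S).
    by rewrite -[X in measurable X]setTI; exact: measurable_pair2.
  by apply/seteqP; split => w /=; [move=> [? []]|move=> []].
rewrite /Q -(integral_cst P mSg) [RHS]integral_mkcond.
apply: eq_integral => w _; rewrite patchE /K /= !indicE g0 mule1.
rewrite (_ : (w \in _) = ((w, g) \in S)); first by case: ((w, g) \in S); rewrite ?mul1e ?mul0e.
by apply/idP/idP; rewrite !inE /=; [move=> [? []]|move=> []].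
Qed.

Definition spectral_integrand (g r : R) : R :=
  (1 - \sum_(z < m_s p)
         zeta p z * Gamma (z.+1)%:R / (beta p - cc p) ^+ z.+1 *
         (1 - \sum_(v < z.+1)
                ((beta p - cc p) * g * r `^ alpha_s p) ^+ v
                / ((gain_main_s p * P_s p) ^+ v * v`!%:R)
                * (-1) ^+ v
                * derive1n v (laplace_transform kappa r)
                    ((beta p - cc p) * g * r `^ alpha_s p
                     / (gain_main_s p * P_s p)))).

Lemma cond_ccdfE g r : 0 < g -> 0 < r -> kappa r `]-oo, 0%R[%classic = 0%E ->
  Phi g r = (spectral_integrand g r)%:E.
Proof.
move=> g0 r0 kr.
have GP0 : 0 < gain_main_s p * P_s p.
  by rewrite mulr_gt0 ?(gain_main_gt0 pv) ?(P_s_gt0 pv).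
pose t := g * r `^ alpha_s p / (gain_main_s p * P_s p).
have t0 : 0 < t by rewrite divr_gt0// mulr_gt0// powR_gt0.
(* As t > 0, the sign test inside [sr_ccdf_pos] is the restriction to y >= 0. *)
transitivity (\int[kappa r]_(y in (`[0%R, +oo[%classic : set (measurableTypeR R)))
    (1 - sr_cdf p (t * y))%:E)%E.
  rewrite [RHS]integral_mkcond; apply: eq_integral => y _.
  have -> : thr g (r, y) = t * y by rewrite /thr /sinr_threshold /t /=; ring.
  rewrite patchE /sr_ccdf_pos (pmulr_rge0 _ t0).
  case: (boolP (0 <= y)) => y0; first by rewrite mem_set//= in_itv /= y0.
  by rewrite memNset//= in_itv /= andbT; exact/negP.
have k1 : kappa r [set: measurableTypeR R] = 1%E by exact: prob_kernel.
rewrite (@integral_sr_ccdf R p pv (kappa r) k1 kr t t0).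
have tE : (beta p - cc p) * t = (beta p - cc p) * g * r `^ alpha_s p
    / (gain_main_s p * P_s p) by rewrite /t; ring.
congr (EFin (1 - _)); apply: eq_bigr => z _.
congr (_ * (1 - _)); apply: eq_bigr => v _.
rewrite tE; congr (_ * _ * _).
have v0 : v`!%:R != 0 :> R by rewrite pnatr_eq0 -lt0n fact_gt0.
by rewrite expr_div_n invfM mulrA.
Qed.

(* The kernel is unconstrained on null sets: only for almost every r of the
   support of f is it carried by the half-line where Laplace transforms are
   smooth. *)
Lemma cond_law_neg_null : P E != 0%E -> exists M : set R,
  [/\ measurable M, lebesgue_measure M = 0%E &
      forall r, ~ M r -> f r = 0 \/ kappa r `]-oo, 0%R[%classic = 0%E].
Proof.
move=> PE0.
have [mf f0 _] := f_density.
have mneg : measurable (`]-oo, 0%R[%classic : set R) by exact: measurable_itv.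
pose g r : \bar R := kappa r (`]-oo, 0%R[%classic : set R).
have mg : measurable_fun setT g by exact: measurable_kernel.
have g0 r : (0 <= g r)%E by exact: measure_ge0.
have [M [mM M0 excM]] := exceptional_negligible pv Nm.
have mEX : measurable (E `&` X @^-1` setT `&` Y @^-1` `]-oo, 0%R[).
  rewrite preimage_setT setIT; apply: measurableI => //.
  by rewrite -[X in measurable X]setTI; exact: mY.
have PN : P (E `&` X @^-1` setT `&` Y @^-1` `]-oo, 0%R[) = 0%E.
  apply/eqP; rewrite -measure_le0 -M0; apply: le_measure; rewrite ?inE//.
  move=> w [_]; rewrite /= in_itv /= => Yn; apply: excM; apply: contrapT => nw.
  have := interference_noise_gt0 o pv (X w) nw.
  by rewrite ltNge ltW.
have kI : (\int[P]_(w in E) g (X w) = 0)%E.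
  have := kappa_law measurableT mneg; rewrite PN preimage_setT setIT => e.
  exact: esym e.
move: kI; rewrite (integral_cond_density mE mX f_density mg g0) => /eqP.
rewrite mule_eq0 (negbTE PE0) /= => /eqP fg0.
have mfg : measurable_fun setT (fun r => (f r)%:E * g r)%E.
  by apply: emeasurable_funM => //; exact/measurable_EFinP.
have : (\int[lebesgue_measure]_r `|(f r)%:E * g r| = 0)%E.
  rewrite -fg0; apply: eq_integral => r _; rewrite gee0_abs// mule_ge0//.
  by rewrite lee_fin.
move=> /(fun h => (ae_eq_integral_abs lebesgue_measure measurableT mfg).1 h)[M' [mM' M'0 hM']].
exists M'; split => // r nM'.
have : ((f r)%:E * g r = 0)%E.
  by apply: contrapT => ne; apply: nM'; apply: hM' => /= h; exact/ne/h.
by move/eqP; rewrite mule_eq0 => /orP[/eqP[fr]|/eqP gr]; [left|right].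
Qed.

(** Off a null set either f(r) = 0, and both integrands vanish, or [kappa r] lives on the half-line,
    and the bracket equals the measurable [Phi g r]. *)
Lemma inner_integralE g : P E != 0%E -> 0 < g ->
  (\int[lebesgue_measure]_(r in `[Rmin_s p, Rmax_s p])
     (spectral_integrand g r * f r * (log2 (expR 1) / (1 + g)))%:E =
   (wt g)%:E * J g)%E.
Proof.
move=> PE0 g0; have [M [mM M0 hM]] := cond_law_neg_null PE0.
have [mf f0 _] := f_density.
rewrite /J -ge0_integralZl//; last 3 first.
- apply: emeasurable_funM; apply: measurable_funTS; last exact: measurable_cond_ccdf.
  exact/measurable_EFinP.
- by move=> r _; rewrite mule_ge0 ?lee_fin// cond_ccdf_ge0.
- by rewrite lee_fin.
apply: (@integral_eq_off _ _ R lebesgue_measure _ _ _ M mM M0) => r; rewrite /= in_itv /= => /andP[r1 _] nM.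
have r0 : 0 < r by rewrite (lt_le_trans (Rmin_gt0 pv)).
have [->|kr] := hM r nM; first by rewrite mulr0 mul0r mul0e mule0.
rewrite (cond_ccdfE g0 r0 kr) -!EFinM; congr EFin.
by rewrite /wt gtr0_norm//; ring.
Qed.

Lemma spectral_efficiency :
  ('E_P[fun w => log2 (1 + SINR p N o w)] =
   P E * \int[lebesgue_measure]_(gamma in `[0%R, +oo[)
     \int[lebesgue_measure]_(r in `[Rmin_s p, Rmax_s p])
       (spectral_integrand gamma r * f r * (log2 (expR 1) / (1 + gamma)))%:E)%E.
Proof.
rewrite expectation_tail.
(* Measurability of [J] will come from dividing [Q] by P(E); if P(E) = 0 both sides vanish. *)
have [PE0|PE0] := eqVneq (P E) 0%E.
  rewrite PE0 mul0e integral0_eq// => g _.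
  by rewrite SINR_tailE PE0 mul0e mule0.
have [mf f0 _] := f_density.
have J0 g : (0 <= J g)%E.
  by apply: integral_ge0 => r _; rewrite mule_ge0 ?lee_fin// cond_ccdf_ge0.
pose c := fine (P E); have cE : c%:E = P E by rewrite fineK// fin_num_measure.
have c0 : c != 0 by apply: contra_neq PE0 => c0; rewrite -cE c0.
have mJ : measurable_fun setT J.
  have -> : J = (fun g => (c^-1)%:E * Q g)%E.
    apply/funext => g; rewrite SINR_tailE -cE muleA -EFinM mulVf// mul1e.
    by [].
  by apply: measurable_funeM; exact: measurable_tail.
transitivity (P E * \int[lebesgue_measure]_(g in `[0%R, +oo[)
    ((wt g)%:E * J g))%E; last first.
  congr (_ * _)%E; apply/esym.
  (* The point gamma = 0 is removed: the Laplace transform would be differentiated at s = 0, outside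
     the range s > 0 covered above. *)
  apply: (@integral_eq_off _ _ R lebesgue_measure _ _ _ ([set 0] : set R)) => //.
    exact: lebesgue_measure_set1.
  move=> g; rewrite /= in_itv /= andbT => g0 /eqP gn0.
  by apply: inner_integralE => //; rewrite lt_neqAle eq_sym gn0.
rewrite -ge0_integralZl//; last 2 first.
- by apply: measurable_funTS; apply: emeasurable_funM => //; exact/measurable_EFinP.
- by move=> g _; rewrite mule_ge0 ?lee_fin.
by apply: eq_integral => g _; rewrite SINR_tailE muleCA.
Qed.

End spectral_efficiency.

Theorem theorem2 (R : realType) (d : measure_display) (T : measurableType d)
    (P : probability T R) (p : params R) (N : network P) (o : mode)
    (f : R -> R)
    (kappa : R.-pker (measurableTypeR R) ~> (measurableTypeR R))
    (p_valid : valid_params p)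
    (N_model : network_model p N)
    (f_density : nearest_distance_density p N f)
    (kappa_law : interference_cond_law p N o kappa) :
  ('E_P[fun w => log2 (1 + SINR p N o w)] =
   (1 - expR (- (lam_tilde_s p * pi * (Rmax_s p ^+ 2 - Rmin_s p ^+ 2))))%:E *
   \int[lebesgue_measure]_(gamma in `[0%R, +oo[)
     \int[lebesgue_measure]_(r in `[Rmin_s p, Rmax_s p])
       ((1 - \sum_(z < m_s p)
               zeta p z * Gamma (z.+1)%:R / (beta p - cc p) ^+ z.+1 *
               (1 - \sum_(v < z.+1)
                      ((beta p - cc p) * gamma * r `^ alpha_s p) ^+ v
                      / ((gain_main_s p * P_s p) ^+ v * v`!%:R)
                      * (-1) ^+ v
                      * derive1n v (laplace_transform kappa r)
                          ((beta p - cc p) * gamma * r `^ alpha_s p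
                           / (gain_main_s p * P_s p))))
        * f r * (log2 (expR 1) / (1 + gamma)))%:E)%E.
Proof.
rewrite -(probability_some_visible p_valid N_model).
exact: spectral_efficiency p_valid N_model f_density kappa_law.
Qed.
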